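(* Let $\Omega=(a,b)$ be a bounded interval, $\lambda\ge0$, $\mu\in(0,1)$, and let $u\in L^2(\Omega)$ be real-valued. Then $$\left\|{}_a\mathbb{D}_x^{-\frac{\mu}{2},\lambda}u\right\|^2_{L^2(\Omega)}\sim\left({}_a\mathbb{D}_x^{-\mu,\lambda}u,\,u\right)=\left(u,\,{}_x\mathbb{D}_b^{-\mu,\lambda}u\right)\sim\left\|{}_x\mathbb{D}_b^{-\frac{\mu}{2},\lambda}u\right\|^2_{L^2(\Omega)},$$ where $(\cdot,\cdot)$ denotes the $L^2(\Omega)$ inner product.
   Context: For $\mu>0$ and $\lambda\ge0$, the left and right tempered Riemann–Liouville fractional integrals are ${}_a\mathbb{D}_x^{-\mu,\lambda}u(x)=\int_a^x\frac{(x-\xi)^{\mu-1}}{\Gamma(\mu)}e^{-\lambda(x-\xi)}u(\xi)\,d\xi$ and ${}_x\mathbb{D}_b^{-\mu,\lambda}u(x)=\int_x^b\frac{(\xi-x)^{\mu-1}}{\Gamma(\mu)}e^{-\lambda(\xi-x)}u(\xi)\,d\xi$. Notation: $A\sim B$ means $C_1B\le A\le C_2B$ with positive constants independent of $u$. *)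

(* Defs.v *)
From HB Require Import structures.
From mathcomp Require Import all_boot all_order all_algebra.
From mathcomp Require Import all_classical all_reals all_analysis.
Set Implicit Arguments. Unset Strict Implicit. Unset Printing Implicit Defensive.
Import Order.TTheory GRing.Theory Num.Theory.
Import numFieldNormedType.Exports.
Local Open Scope classical_set_scope.
Local Open Scope ring_scope.

Definition Gamma (R : realType) (s : R) : R :=
  Rintegral lebesgue_measure `]0, +oo[ (fun t => t `^ (s - 1) * expR (- t)).

Definition ltRL (R : realType) (a mu lam : R) (u : R -> R) (x : R) : R :=
  Rintegral lebesgue_measure `]a, x[
    (fun xi => (x - xi) `^ (mu - 1) / Gamma mu * expR (- (lam * (x - xi))) * u xi).

Definition rtRL (R : realType) (b mu lam : R) (u : R -> R) (x : R) : R :=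
  Rintegral lebesgue_measure `]x, b[
    (fun xi => (xi - x) `^ (mu - 1) / Gamma mu * expR (- (lam * (xi - x))) * u xi).

Definition L2inner (R : realType) (a b : R) (f g : R -> R) : R :=
  Rintegral lebesgue_measure `]a, b[ (fun x => f x * g x).

Definition L2normsq (R : realType) (a b : R) (f : R -> R) : R :=
  Rintegral lebesgue_measure `]a, b[ (fun x => f x ^+ 2).

Definition inL2 (R : realType) (a b : R) (u : R -> R) : Prop :=
  measurable_fun `]a, b[ u /\
  (\int[lebesgue_measure]_(x in `]a, b[) ((u x) ^+ 2)%:E < +oo)%E.

(* Main.v *)
(** Write [v = e^(lam x) u] and [w = e^(- lam x) u] on [(a, b)], extended by
    zero, and let [L], [L'] be the left and right Riemann-Liouville operators of
    order [al = mu / 2] on the line with [lam = 0].  Up to Gamma factors the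
    tempered integrals of [u] are [e^(- lam x) L v] and [e^(lam x) L' w], and
    [I] is [(w, L^2 v)].

    Fubini and the scaling of [z^(al-1)] give two identities: the Beta integral
    [(w, L^2 v) = c (L' w, L v)], and, on the whole line,
    [||L v||^2 = C (v, L^2 v)], because the correlation of the kernel of [L]
    with itself is a multiple of [|x - y|^(mu-1)]; convergence at infinity is
    where [mu < 1] is needed.

    The second identity applied to the truncations [v 1_(x < z)] shows that
    every partial integral of [h = v L^2 v] is nonnegative.  As [e^(-2 lam x)]
    decreases, summation by parts yields
    [I = int e^(-2 lam x) h >= e^(-2 lam b) int h], hence the left norm is
    bounded by [I]; reflecting the interval does the same for the right norm.
    The converse bounds follow from [I = c (right, left)] and the inequality
    [2 r l <= t r^2 + l^2 / t], with [t] chosen so that one of the two terms is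
    absorbed by [I]. *)
Require Import Defs.
From HB Require Import structures.
From mathcomp Require Import all_boot all_order all_algebra.
From mathcomp Require Import all_classical all_reals all_analysis.
From mathcomp Require Import measurable_realfun ring lra.
Set Implicit Arguments. Unset Strict Implicit. Unset Printing Implicit Defensive.
Import Order.TTheory GRing.Theory Num.Theory.
Import numFieldNormedType.Exports.
Local Open Scope classical_set_scope.
Local Open Scope ring_scope.

(** * Fubini for real-valued iterated integrals *)

Section real_integral.
Context d (T : measurableType d) (R : realType).
Context (m : {measure set T -> \bar R}).

(* Outside the integrable case both sides vanish, since [fine] kills
   infinities. *)
Lemma RintegralZl_measurable (f : T -> R) (r : R) : measurable_fun setT f ->
  \int[m]_x (r * f x) = r * \int[m]_x f x.
Proof.
move=> mf; have [intf|nintf] := pselect (m.-integrable setT (EFin \o f)).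
  by rewrite RintegralZl.
have [->|r0] := eqVneq r 0.
  by under eq_Rintegral do rewrite mul0r; rewrite Rintegral_cst// !mul0r.
have fine0 (g : T -> R) : measurable_fun setT g ->
    ~ m.-integrable setT (EFin \o g) -> \int[m]_x g x = 0.
  move=> mg ng; apply: contrapT => /eqP g0; apply: ng.
  apply/integrableP; split; first exact/measurable_EFinP.
  rewrite integral_fin_num_abs// fin_numE; apply/andP; split;
    by apply: contra_neqN g0 => /eqP; rewrite /Rintegral => ->.
rewrite (fine0 f)// fine0 ?mulr0//; first exact: measurable_funM.
move=> nint; apply: nintf.
have -> : EFin \o f = (fun x => r^-1%:E * (EFin \o (fun x => r * f x)%R) x)%E.
  by apply/funext => x /=; rewrite -EFinM mulrA mulVf// mul1r.
exact: integrableZl.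
Qed.

Lemma RintegralZr_measurable (f : T -> R) (r : R) : measurable_fun setT f ->
  \int[m]_x (f x * r) = (\int[m]_x f x) * r.
Proof.
move=> mf; rewrite mulrC -RintegralZl_measurable//.
by under eq_Rintegral do rewrite mulrC.
Qed.

Lemma le_normr_Rintegral_measurable (f : T -> R) : measurable_fun setT f ->
  (`|\int[m]_x f x|%:E <= \int[m]_x `|f x|%:E)%E.
Proof.
move=> mf; apply: (@le_trans _ _ (`| \int[m]_x (f x)%:E |)%E).
  by rewrite /Rintegral; case: (\int[m]_x (f x)%:E)%E => [r| |] /=;
    rewrite ?normr0 ?leey.
by apply: le_abse_integral => //; exact/measurable_EFinP.
Qed.

Lemma ae_eq_Rintegral (f g : T -> R) :
  measurable_fun setT f -> measurable_fun setT g ->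
  {ae m, forall x, f x = g x} -> \int[m]_x f x = \int[m]_x g x.
Proof.
move=> mf mg fg; congr fine; apply: ae_eq_integral => //.
- exact/measurable_EFinP.
- exact/measurable_EFinP.
- by apply: filterS fg => x /= -> _.
Qed.

End real_integral.

Section real_fubini.
Context d1 d2 (T1 : measurableType d1) (T2 : measurableType d2) (R : realType).
Context (m1 : {sigma_finite_measure set T1 -> \bar R}).
Context (m2 : {sigma_finite_measure set T2 -> \bar R}).
Implicit Type f : T1 -> T2 -> R.

Lemma measurable_sec1 f x : measurable_fun setT (fun p => f p.1 p.2) ->
  measurable_fun setT (f x).
Proof.
by move=> mf; exact: (measurableT_comp mf (pair1_measurable x)).
Qed.

Lemma measurable_sec2 f y : measurable_fun setT (fun p => f p.1 p.2) ->
  measurable_fun setT (f ^~ y).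
Proof.
by move=> mf; exact: (measurableT_comp mf (pair2_measurable y)).
Qed.

Lemma measurable_fun_swap d3 (T3 : measurableType d3) (f : T1 -> T2 -> T3) :
  measurable_fun setT (fun p => f p.1 p.2) ->
  measurable_fun setT (fun p => f p.2 p.1).
Proof.
move=> mf; have := measurableT_comp mf (@measurable_swap _ _ T2 T1).
exact.
Qed.

(** Tonelli gives measurability for [f^\+] and [f^\-] separately; the difference of their section
    integrals is the integral of [f] at every [x], without any integrability assumption. *)
Lemma measurable_integral_sec (f : T1 -> T2 -> \bar R) :
  measurable_fun setT (fun p => f p.1 p.2) ->
  measurable_fun setT (fun x => \int[m2]_y f x y)%E.
Proof.
move=> mf; pose g p := f p.1 p.2.
rewrite (_ : (fun x => _) = fubini_F m2 g^\+ \- fubini_F m2 g^\-)%E.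
  apply: emeasurable_funB; apply: measurable_fun_fubini_tonelli_F => //.
  - exact: measurable_funepos.
  - exact: measurable_funeneg.
apply/funext => x; rewrite integralE /fubini_F.
by congr (_ - _)%E; apply: eq_integral => y _; rewrite ?funeposE ?funenegE.
Qed.

Lemma measurable_Rintegral_sec f : measurable_fun setT (fun p => f p.1 p.2) ->
  measurable_fun setT (fun x => \int[m2]_y f x y).
Proof.
move=> mf; apply: measurableT_comp => //.
by apply: measurable_integral_sec; exact/measurable_EFinP.
Qed.

End real_fubini.

Section real_fubini.
Context d1 d2 (T1 : measurableType d1) (T2 : measurableType d2) (R : realType).
Context (m1 : {sigma_finite_measure set T1 -> \bar R}).
Context (m2 : {sigma_finite_measure set T2 -> \bar R}).

Lemma measurable_integral_sec2 (f : T1 -> T2 -> \bar R) :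
  measurable_fun setT (fun p => f p.1 p.2) ->
  measurable_fun setT (fun y => \int[m1]_x f x y)%E.
Proof.
move=> mf; apply: (@measurable_integral_sec _ _ _ _ _ _ (fun y x => f x y)).
exact: measurable_fun_swap.
Qed.

Lemma measurable_Rintegral_sec2 (f : T1 -> T2 -> R) :
  measurable_fun setT (fun p => f p.1 p.2) ->
  measurable_fun setT (fun y => \int[m1]_x f x y).
Proof.
move=> mf; apply: (@measurable_Rintegral_sec _ _ _ _ _ _ (fun y x => f x y)).
exact: measurable_fun_swap.
Qed.

Lemma integrable_Rintegral_sec (f : T1 -> T2 -> R) :
  measurable_fun setT (fun p => f p.1 p.2) ->
  (\int[m1]_x \int[m2]_y `|f x y|%:E < +oo)%E ->
  m1.-integrable setT (EFin \o (fun x => \int[m2]_y f x y)).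
Proof.
move=> mf foo; apply/integrableP; split.
  by apply/measurable_EFinP; exact: measurable_Rintegral_sec.
apply: le_lt_trans foo; apply: ge0_le_integral => //=.
- apply/measurable_EFinP; apply: measurableT_comp => //.
  exact: measurable_Rintegral_sec.
- apply: (@measurable_integral_sec _ _ _ _ _ _ (fun x y => `|f x y|%:E)).
  by apply/measurable_EFinP; exact: measurableT_comp.
- by move=> x _; apply: le_normr_Rintegral_measurable; exact: measurable_sec1.
Qed.

(** [fine] may alter an inner integral when the section is not integrable, so the real inner
    integrals agree with those of the extended Fubini theorem only almost everywhere. This suffices,
    since the outer integrals ignore null sets. *)
Lemma Rintegral_fubini (f : T1 -> T2 -> R) :
  measurable_fun setT (fun p => f p.1 p.2) ->
  (\int[m1]_x \int[m2]_y `|f x y|%:E < +oo)%E ->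
  \int[m1]_x \int[m2]_y f x y = \int[m2]_y \int[m1]_x f x y.
Proof.
move=> mf foo; pose g p := (f p.1 p.2)%:E.
have mg : measurable_fun setT g by exact/measurable_EFinP.
have ig : (m1 \x m2)%E.-integrable setT g.
  by apply/integrable12ltyP => //; apply: le_lt_trans foo.
congr fine.
rewrite (ae_eq_integral (fubini_F m2 g))//; last 3 first.
- by apply/measurable_EFinP; exact: measurable_Rintegral_sec.
- exact: (measurable_fubini_F ig).
- apply: filterS (ae_integrable1 ig) => x Fx _.
  by rewrite /Rintegral fineK//; exact: integrable_fin_num.
rewrite [RHS](ae_eq_integral (fubini_G m1 g))//; first exact: Fubini.
- by apply/measurable_EFinP; exact: measurable_Rintegral_sec2.
- exact: (measurable_fubini_G ig).
- apply: filterS (ae_integrable2 ig) => x Fx _.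
  by rewrite /Rintegral fineK//; exact: integrable_fin_num.
Qed.

(** Inner integrals add up where both sections are integrable; absolute convergence of the double
    integrals provides this at almost every [x]. *)
Lemma Rintegral2D (f g : T1 -> T2 -> R) :
  measurable_fun setT (fun p => f p.1 p.2) ->
  measurable_fun setT (fun p => g p.1 p.2) ->
  (\int[m1]_x \int[m2]_y `|f x y|%:E < +oo)%E ->
  (\int[m1]_x \int[m2]_y `|g x y|%:E < +oo)%E ->
  \int[m1]_x \int[m2]_y (f x y + g x y) =
  \int[m1]_x \int[m2]_y f x y + \int[m1]_x \int[m2]_y g x y.
Proof.
move=> mf mg foo goo.
have aei (h : T1 -> T2 -> R) : measurable_fun setT (fun p => h p.1 p.2) ->
    (\int[m1]_x \int[m2]_y `|h x y|%:E < +oo)%E ->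
    {ae m1, forall x, m2.-integrable setT (fun y => (h x y)%:E)}.
  move=> mh hoo.
  apply: (@ae_integrable1 _ _ _ _ _ m1 m2 (fun p => (h p.1 p.2)%:E)).
  by apply/integrable12ltyP => //; exact/measurable_EFinP.
rewrite -RintegralD//; [|exact: integrable_Rintegral_sec..].
apply: ae_eq_Rintegral.
- apply: (@measurable_Rintegral_sec _ _ _ _ _ _ (fun x y => f x y + g x y)).
  exact: measurable_funD.
- by apply: measurable_funD; exact: measurable_Rintegral_sec.
- apply: filterS2 (aei _ mf foo) (aei _ mg goo) => x xf xg.
  by rewrite RintegralD.
Qed.

Lemma tonelli (f : T1 -> T2 -> \bar R) :
  measurable_fun setT (fun p => f p.1 p.2) -> (forall x y, 0 <= f x y)%E ->
  (\int[m1]_x \int[m2]_y f x y = \int[m2]_y \int[m1]_x f x y)%E.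
Proof. by move=> mf f0; apply: (fubini_tonelli (fun p => f p.1 p.2)). Qed.

End real_fubini.

(** * Integral operators with nonnegative kernels *)

Section gram.
Context dx dy dz (X : measurableType dx) (Y : measurableType dy)
  (Z : measurableType dz) (R : realType).
Context (mX : {sigma_finite_measure set X -> \bar R}).
Context (mY : {sigma_finite_measure set Y -> \bar R}).
Context (mZ : {sigma_finite_measure set Z -> \bar R}).
Context (phi : Z -> X -> R) (psi : Z -> Y -> R) (k : X -> Y -> R).
Hypothesis mphi : measurable_fun setT (fun p => phi p.1 p.2).
Hypothesis mpsi : measurable_fun setT (fun p => psi p.1 p.2).
Hypothesis mk : measurable_fun setT (fun p => k p.1 p.2).
Hypothesis phi0 : forall z x, 0 <= phi z x.
Hypothesis psi0 : forall z y, 0 <= psi z y.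
Hypothesis k0 : forall x y, 0 <= k x y.
(** [k] is the kernel of the operator of kernel [psi] followed by the transpose of the one of kernel
    [phi], so that [(Phi f, Psi g) = (f, K g)] is expected. Equality is asked only for almost every
    [y], because the correlation integral treated later diverges on the diagonal. *)
Hypothesis kE : forall x, {ae mY, forall y,
  (\int[mZ]_z (phi z x * psi z y)%:E = (k x y)%:E)%E}.

Lemma comp_kernel_tonelli (g : Y -> R) x : measurable_fun setT g ->
  (forall y, 0 <= g y) ->
  (\int[mZ]_z ((phi z x)%:E * \int[mY]_y (psi z y * g y)%:E) =
   \int[mY]_y (k x y * g y)%:E)%E.
Proof.
move=> mg g0.
have mpsig : measurable_fun setT (fun p => psi p.1 p.2 * g p.2).
  by apply: measurable_funM => //; exact: measurableT_comp.
have mphix : measurable_fun setT (phi ^~ x) by exact: measurable_sec2.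
have mphipsig : measurable_fun setT
    (fun p => (phi p.1 x * (psi p.1 p.2 * g p.2))%:E).
  apply/measurable_EFinP; apply: measurable_funM => //.
  exact: measurableT_comp mphix measurable_fst.
transitivity (\int[mZ]_z \int[mY]_y (phi z x * (psi z y * g y))%:E)%E.
  apply: eq_integral => z _; rewrite -ge0_integralZl//.
  - apply/measurable_EFinP.
    exact: (@measurable_sec1 _ _ _ _ _ (fun z y => psi z y * g y)).
  - by move=> y _; rewrite lee_fin mulr_ge0.
  - by rewrite lee_fin.
rewrite (@tonelli _ _ _ _ _ _ _ (fun z y => (phi z x * (psi z y * g y))%:E))//.
- apply: ge0_ae_eq_integral => //.
  + exact: (@measurable_integral_sec2 _ _ _ _ _ _
      (fun z y => (phi z x * (psi z y * g y))%:E)).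
  + apply/measurable_EFinP; apply: measurable_funM => //.
    exact: measurable_sec1.
  + by move=> y _; apply: integral_ge0 => z _; rewrite lee_fin !mulr_ge0.
  + by move=> y _; rewrite lee_fin mulr_ge0.
  + apply: filterS (kE x) => y kxy _.
    rewrite EFinM -kxy -ge0_integralZr//.
    * by apply: eq_integral => z _; rewrite -EFinM mulrA.
    * apply/measurable_EFinP; apply: measurable_funM => //.
      exact: measurable_sec2.
    * by move=> z _; rewrite lee_fin mulr_ge0.
    * by rewrite lee_fin.
- by move=> z y; rewrite lee_fin !mulr_ge0.
Qed.

(** For nonnegative data, Tonelli in [(z, x)] and then, at each [x], in [(z, y)] composes the
    kernels. Applied to [|f|] and [|g|], it turns finiteness of the form of [k] into the absolute
    convergence required by the signed version. *)
Lemma gram_tonelli (f : X -> R) (g : Y -> R) :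
  measurable_fun setT f -> measurable_fun setT g ->
  (forall x, 0 <= f x) -> (forall y, 0 <= g y) ->
  (\int[mZ]_z ((\int[mX]_x (phi z x * f x)%:E) *
               (\int[mY]_y (psi z y * g y)%:E)) =
   \int[mX]_x ((f x)%:E * \int[mY]_y (k x y * g y)%:E))%E.
Proof.
move=> mf mg f0 g0.
set Psi := fun z => (\int[mY]_y (psi z y * g y)%:E)%E.
have Psi0 z : (0 <= Psi z)%E.
  by apply: integral_ge0 => y _; rewrite lee_fin mulr_ge0.
have mPsi : measurable_fun setT Psi.
  apply: (@measurable_integral_sec _ _ _ _ _ _ (fun z y => (psi z y * g y)%:E)).
  apply/measurable_EFinP/measurable_funM => //; exact: measurableT_comp.
have mphif : measurable_fun setT (fun p => phi p.1 p.2 * f p.2).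
  by apply: measurable_funM => //; exact: measurableT_comp.
transitivity (\int[mZ]_z \int[mX]_x ((phi z x * f x)%:E * Psi z))%E.
  apply: eq_integral => z _; rewrite -ge0_integralZr//.
  - apply/measurable_EFinP.
    exact: (@measurable_sec1 _ _ _ _ _ (fun z x => phi z x * f x)).
  - by move=> x _; rewrite lee_fin mulr_ge0.
  - exact: Psi0.
rewrite (@tonelli _ _ _ _ _ _ _ (fun z x => ((phi z x * f x)%:E * Psi z)%E)).
- apply: eq_integral => x _; rewrite -comp_kernel_tonelli// -ge0_integralZl//.
  + by apply: eq_integral => z _; rewrite muleA -EFinM (mulrC (f x)).
  + apply: emeasurable_funM => //; apply/measurable_EFinP.
    exact: measurable_sec2.
  + by move=> z _; apply: mule_ge0; [rewrite lee_fin|exact: Psi0].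
  + by rewrite lee_fin.
- apply: emeasurable_funM; first exact/measurable_EFinP.
  exact: measurableT_comp mPsi measurable_fst.
- by move=> z x; apply: mule_ge0 => //; rewrite lee_fin mulr_ge0.
Qed.

Lemma gram_Rintegral (f : X -> R) (g : Y -> R) :
  measurable_fun setT f -> measurable_fun setT g ->
  (\int[mX]_x (`|f x|%:E * \int[mY]_y (k x y * `|g y|)%:E) < +oo)%E ->
  \int[mZ]_z ((\int[mX]_x (phi z x * f x)) * (\int[mY]_y (psi z y * g y))) =
  \int[mX]_x (f x * \int[mY]_y (k x y * g y)).
Proof.
move=> mf mg foo.
have mpsig : measurable_fun setT (fun p => psi p.1 p.2 * g p.2).
  by apply: measurable_funM => //; exact: measurableT_comp.
have mphif : measurable_fun setT (fun p => phi p.1 p.2 * f p.2).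
  by apply: measurable_funM => //; exact: measurableT_comp.
set G := fun z => \int[mY]_y (psi z y * g y).
have mG : measurable_fun setT G.
  exact: (@measurable_Rintegral_sec _ _ _ _ _ _ (fun z y => psi z y * g y)).
have mphifG : measurable_fun setT (fun p => phi p.1 p.2 * f p.2 * G p.1).
  by apply: measurable_funM => //; exact: measurableT_comp.
transitivity (\int[mZ]_z \int[mX]_x (phi z x * f x * G z)).
  apply: eq_Rintegral => z _; rewrite RintegralZr_measurable//.
  exact: (@measurable_sec1 _ _ _ _ _ (fun z x => phi z x * f x)).
have mnf : measurable_fun setT (fun x => `|f x|) by exact: measurableT_comp.
have mng : measurable_fun setT (fun y => `|g y|) by exact: measurableT_comp.
have mkg : measurable_fun setT (fun p => k p.1 p.2 * g p.2).
  by apply: measurable_funM => //; exact: measurableT_comp.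
have mkng : measurable_fun setT (fun x => \int[mY]_y (k x y * `|g y|)%:E)%E.
  apply: (@measurable_integral_sec _ _ _ _ _ _ (fun x y => (k x y * `|g y|)%:E)).
  by apply/measurable_EFinP/measurable_funM => //;
    exact: measurableT_comp mng measurable_snd.
have kg0 x : (0 <= \int[mY]_y (k x y * `|g y|)%:E)%E.
  by apply: integral_ge0 => y _; rewrite lee_fin mulr_ge0.
rewrite (@Rintegral_fubini _ _ _ _ _ _ _ (fun z x => phi z x * f x * G z))//.
- apply: ae_eq_Rintegral.
  + exact: (@measurable_Rintegral_sec2 _ _ _ _ _ _
      (fun z x => phi z x * f x * G z)).
  + apply: measurable_funM => //.
    exact: (@measurable_Rintegral_sec _ _ _ _ _ _ (fun x y => k x y * g y)).
  have /integrable_ae - /(_ measurableT) : mX.-integrable setT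
      (fun x => `|f x|%:E * \int[mY]_y (k x y * `|g y|)%:E)%E.
    apply/integrableP; split.
      by apply: emeasurable_funM => //; exact/measurable_EFinP.
    apply: le_lt_trans foo; under eq_integral => x _.
      rewrite gee0_abs; last by rewrite mule_ge0.
      over.
    exact: lexx.
  (* Finiteness is known only for the product of [|f x|] with the inner integral. Where [f x = 0]
     both sides vanish; elsewhere the inner integral itself is finite and a second Fubini
     applies. *)
  apply: filterS => x /(_ I) finx.
  have [fx0|fx0] := eqVneq (f x) 0.
    rewrite fx0 mul0r; under eq_Rintegral do rewrite mulr0 mul0r.
    by rewrite Rintegral_cst// mul0r.
  have {}finx : (\int[mY]_y (k x y * `|g y|)%:E < +oo)%E.
    rewrite ltNge leye_eq; apply/eqP => kgoo; move: finx.
    by rewrite kgoo gt0_muley// lte_fin normr_gt0.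
  under eq_Rintegral do rewrite mulrAC mulrC.
  have mphix : measurable_fun setT (phi ^~ x) by exact: measurable_sec2.
  rewrite RintegralZl_measurable; last exact: measurable_funM.
  congr (_ * _).
  transitivity (\int[mZ]_z \int[mY]_y (phi z x * (psi z y * g y))).
    apply: eq_Rintegral => z _; rewrite RintegralZl_measurable//.
    exact: (@measurable_sec1 _ _ _ _ _ (fun z y => psi z y * g y)).
  have mphipsig : measurable_fun setT
      (fun p => phi p.1 x * (psi p.1 p.2 * g p.2)).
    apply: measurable_funM => //.
    exact: measurableT_comp mphix measurable_fst.
  rewrite (@Rintegral_fubini _ _ _ _ _ _ _
    (fun z y => phi z x * (psi z y * g y)))//.
  + apply: ae_eq_Rintegral.
    * exact: (@measurable_Rintegral_sec2 _ _ _ _ _ _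
        (fun z y => phi z x * (psi z y * g y))).
    * by apply: measurable_funM => //; exact: measurable_sec1.
    apply: filterS (kE x) => y kxy.
    under eq_Rintegral do rewrite mulrA.
    rewrite RintegralZr_measurable; last first.
      by apply: measurable_funM => //; exact: measurable_sec2.
    by rewrite /Rintegral kxy.
  + apply: le_lt_trans finx; rewrite -comp_kernel_tonelli//.
    rewrite le_eqVlt; apply/orP; left; apply/eqP.
    apply: eq_integral => z _; rewrite -ge0_integralZl//.
    * by apply: eq_integral => y _; rewrite !normrM !(ger0_norm (phi0 _ _))
        !(ger0_norm (psi0 _ _)) EFinM.
    * by apply/measurable_EFinP/measurable_funM => //; exact: measurable_sec1.
    * by move=> y _; rewrite lee_fin mulr_ge0.
    * by rewrite lee_fin.
- apply: le_lt_trans foo; rewrite -gram_tonelli//.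
  apply: ge0_le_integral => //=.
  + by move=> z _; exact: integral_ge0.
  + apply: (@measurable_integral_sec _ _ _ _ _ _
      (fun z x => `|phi z x * f x * G z|%:E)).
    by apply/measurable_EFinP; exact: measurableT_comp.
  + apply: emeasurable_funM.
    * apply: (@measurable_integral_sec _ _ _ _ _ _
        (fun z x => (phi z x * `|f x|)%:E)).
      by apply/measurable_EFinP/measurable_funM => //;
    exact: measurableT_comp mnf measurable_snd.
    * apply: (@measurable_integral_sec _ _ _ _ _ _
        (fun z y => (psi z y * `|g y|)%:E)).
      by apply/measurable_EFinP/measurable_funM => //;
    exact: measurableT_comp mng measurable_snd.
  + move=> z _; under eq_integral do rewrite normrM EFinM.
    rewrite ge0_integralZr//.
    * apply: lee_pmul => //; first exact: integral_ge0.
      - by rewrite le_eqVlt; apply/orP; left; apply/eqP; apply: eq_integral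
          => x _; rewrite normrM ger0_norm.
      - apply: le_trans (le_normr_Rintegral_measurable _ _) _.
          exact: (@measurable_sec1 _ _ _ _ _ (fun z y => psi z y * g y)).
        by rewrite le_eqVlt; apply/orP; left; apply/eqP; apply: eq_integral
          => y _; rewrite normrM ger0_norm.
    * apply/measurable_EFinP; apply: measurableT_comp => //.
      exact: (@measurable_sec1 _ _ _ _ _ (fun z x => phi z x * f x)).
Qed.

(** An identity between real integrals does not show integrability, since [fine] turns infinity into
    0. It follows here from the domination by the same form in absolute values. *)
Lemma gram_integrable (f : X -> R) (g : Y -> R) :
  measurable_fun setT f -> measurable_fun setT g ->
  (\int[mX]_x (`|f x|%:E * \int[mY]_y (k x y * `|g y|)%:E) < +oo)%E ->
  mZ.-integrable setT (EFin \o (fun z =>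
    (\int[mX]_x (phi z x * f x)) * (\int[mY]_y (psi z y * g y)))).
Proof.
move=> mf mg foo.
have mnf : measurable_fun setT (fun x => `|f x|) by exact: measurableT_comp.
have mng : measurable_fun setT (fun y => `|g y|) by exact: measurableT_comp.
have mpsig : measurable_fun setT (fun p => psi p.1 p.2 * g p.2).
  by apply: measurable_funM => //; exact: measurableT_comp.
have mphif : measurable_fun setT (fun p => phi p.1 p.2 * f p.2).
  by apply: measurable_funM => //; exact: measurableT_comp.
have mF := @measurable_Rintegral_sec _ _ _ _ _ mX (fun z x => phi z x * f x) mphif.
have mG := @measurable_Rintegral_sec _ _ _ _ _ mY (fun z y => psi z y * g y) mpsig.
apply/integrableP; split.
  by apply/measurable_EFinP; exact: measurable_funM.
apply: le_lt_trans foo; rewrite -gram_tonelli//.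
apply: ge0_le_integral => //=.
- apply/measurable_EFinP; apply: measurableT_comp => //; exact: measurable_funM.
- apply: emeasurable_funM.
  + apply: (@measurable_integral_sec _ _ _ _ _ _
      (fun z x => (phi z x * `|f x|)%:E)).
    apply/measurable_EFinP/measurable_funM => //.
    exact: measurableT_comp mnf measurable_snd.
  + apply: (@measurable_integral_sec _ _ _ _ _ _
      (fun z y => (psi z y * `|g y|)%:E)).
    apply/measurable_EFinP/measurable_funM => //.
    exact: measurableT_comp mng measurable_snd.
move=> z _; rewrite normrM EFinM; apply: lee_pmul => //.
- apply: le_trans (le_normr_Rintegral_measurable _ _) _.
    exact: (@measurable_sec1 _ _ _ _ _ (fun z x => phi z x * f x)).
  by rewrite le_eqVlt; apply/orP; left; apply/eqP; apply: eq_integral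
    => x _; rewrite normrM ger0_norm.
- apply: le_trans (le_normr_Rintegral_measurable _ _) _.
    exact: (@measurable_sec1 _ _ _ _ _ (fun z y => psi z y * g y)).
  by rewrite le_eqVlt; apply/orP; left; apply/eqP; apply: eq_integral
    => y _; rewrite normrM ger0_norm.
Qed.

End gram.

(** * Power kernels *)

Section affine.
Context {R : realType}.
Local Notation leb := (@lebesgue_measure R).

(** Lebesgue measure is [c] times its pushforward under [x |-> c * x + d], by uniqueness from
    half-open intervals; integrals are then transferred along the pushforward. *)
Lemma ge0_integral_affine (f : R -> \bar R) (c d : R) : 0 < c ->
  measurable_fun setT f -> (forall x, 0 <= f x)%E ->
  (\int[leb]_x f x = c%:E * \int[leb]_x f (c * x + d)%R)%E.
Proof.
move=> c0 mf f0.
pose phi : measurableTypeR R -> measurableTypeR R := fun x => c * x + d.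
have mphi : measurable_fun setT phi.
  by apply: measurable_funD => //; exact: measurable_funM.
pose mphi_mixin := isMeasurableFun.Build _ _ _ _ phi mphi.
pose F : {mfun _ >-> _} := HB.pack phi mphi_mixin.
pose nc := NngNum (ltW c0).
have E A : measurable A -> leb A = mscale nc (pushforward leb F) A.
  apply: lebesgue_measure_unique => _ [[a b] _ <-]/=.
  rewrite /mscale /= /pushforward /=.
  have -> : phi @^-1` `]a, b]%classic = `](a - d) / c, (b - d) / c]%classic.
    apply/seteqP; split => x /=; rewrite /phi !in_itv/=.
    - by rewrite ltr_pdivrMr// ler_pdivlMr// (mulrC x) ltrBlDr lerBrDr.
    - by rewrite ltr_pdivrMr// ler_pdivlMr// (mulrC x) ltrBlDr lerBrDr.
  rewrite !lebesgue_measure_itv/= !lte_fin ltr_pM2r ?invr_gt0// ltrD2r.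
  case: ifPn => ab; last by rewrite mule0.
  by rewrite -!EFinB -EFinM -mulrBl mulrC divfK ?gt_eqF//; congr (_%:E); ring.
rewrite (eq_measure_integral (mscale nc (pushforward leb F))); last first.
  by move=> A mA _; exact: E.
rewrite ge0_integral_mscale//= ge0_integral_pushforward//.
Qed.

Lemma ge0_integral_reflect (f : R -> \bar R) (D : set R) : measurable D ->
  measurable_fun D f -> {in D, forall x, 0 <= f x}%E ->
  (\int[leb]_(x in D) f x = \int[leb]_(x in -%R @^-1` D) f (- x)%R)%E.
Proof.
move=> mD mf f0.
have mN : measurable_fun setT (-%R : measurableTypeR R -> measurableTypeR R).
  exact: oppr_measurable.
rewrite (eq_measure_integral
    (pushforward leb (-%R : measurableTypeR R -> measurableTypeR R))).
  by rewrite (ge0_integral_pushforward mN).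
by move=> A mA _; exact/esym/lebesgue_measureN.
Qed.

Lemma integral_reflect (f : R -> \bar R) (D : set R) : measurable D ->
  measurable_fun D f ->
  (\int[leb]_(x in D) f x = \int[leb]_(x in -%R @^-1` D) f (- x)%R)%E.
Proof.
move=> mD mf; rewrite integralE [RHS]integralE; congr (_ - _)%E.
- rewrite (@ge0_integral_reflect (f^\+)%E)//; last exact: measurable_funepos.
  by apply: eq_integral => x _; rewrite !funeposE.
- rewrite (@ge0_integral_reflect (f^\-)%E)//; last exact: measurable_funeneg.
  by apply: eq_integral => x _; rewrite !funenegE.
Qed.

Lemma Rintegral_reflect (f : R -> R) (a b : R) : measurable_fun `]a, b[ f ->
  \int[leb]_(x in `]a, b[) f x = \int[leb]_(x in `](- b), (- a)[) f (- x).
Proof.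
move=> mf; rewrite /Rintegral integral_reflect//; last exact/measurable_EFinP.
by rewrite opp_preimage_itvbndbnd.
Qed.

End affine.

(** * Truncated powers: integrability, Beta integral, correlation *)

Section power_kernel.
Context {R : realType}.
Local Notation leb := (@lebesgue_measure R).
Implicit Types s t a b : R.

(** The causal kernel [t_+^(s-1)], without its Gamma factor. The cutoff lets the one-sided
    fractional integrals be written as convolutions over the whole line. *)
Definition pker s t : R := if 0 < t then t `^ (s - 1) else 0.

Lemma pker_ge0 s t : 0 <= pker s t.
Proof. by rewrite /pker; case: ifP => // _; exact: powR_ge0. Qed.

Lemma le0_ger_powR (r u v : R) : r <= 0 -> 0 < u -> u <= v -> v `^ r <= u `^ r.
Proof.
move=> r0 u0 uv; have v0 := lt_le_trans u0 uv.
rewrite -(opprK r) !(powRN _ (- r)) lef_pV2 ?posrE ?powR_gt0//.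
by apply: ge0_ler_powR; rewrite ?nnegrE ?oppr_ge0// ltW.
Qed.

Lemma powR_ge1 (r u : R) : r <= 0 -> 0 < u -> u <= 1 -> 1 <= u `^ r.
Proof.
move=> r0 u0 u1; have <- : 1 `^ r = 1 :> R by rewrite powR1.
exact: le0_ger_powR.
Qed.

Lemma measurable_pker s : measurable_fun setT (pker s).
Proof.
by apply: measurable_fun_ifT => //; exact: measurable_fun_ltr.
Qed.

Lemma gt0_powRD (t r s : R) : 0 < t -> t `^ (r + s) = t `^ r * t `^ s.
Proof.
by move=> t0; rewrite powRD//; apply/implyP => _; rewrite gt_eqF.
Qed.

(** The weight produced by a substitution of ratio [t] in a product of two kernels of order [al]:
    the Jacobian and two factors [t^(al-1)]. *)
Lemma pkerDD (al t : R) : 0 < t ->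
  t * (t `^ (al - 1) * t `^ (al - 1)) = pker (al + al) t.
Proof.
move=> t0; rewrite /pker t0 -{1}(powRr1 (ltW t0)) -!gt0_powRD//.
by congr (_ `^ _); ring.
Qed.

Lemma pkerM s c t : 0 < c -> pker s (c * t) = c `^ (s - 1) * pker s t.
Proof.
move=> c0; rewrite /pker pmulr_rgt0//; case: ifPn => t0; last by rewrite mulr0.
by rewrite powRM// ltW.
Qed.

Lemma integral_powR_itvcc (q a b : R) : q != 0 -> 0 < a -> a < b ->
  (\int[leb]_(t in `[a, b]) (t `^ (q - 1))%:E =
    ((b `^ q - a `^ q) / q)%:E)%E.
Proof.
move=> q0 a0 ab; have b0 := lt_trans a0 ab.
have drv (r x : R) : 0 < x -> derivable (fun t : R => t `^ r) x 1.
  by move=> x0; apply: derivable_powR; rewrite in_itv/= x0.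
have cnt (r x : R) : 0 < x -> (t `^ r) @[t --> x] --> x `^ r.
  move=> x0; have /derivable1_diffP/differentiable_continuous := drv r x x0.
  exact.
rewrite (@continuous_FTC2 _ _ (fun t => q^-1 * t `^ q))//.
- by rewrite -EFinB; congr (_%:E); rewrite -mulrBr mulrC.
- apply: derivable_within_continuous => x /itvP xab; apply: drv.
  by rewrite (lt_le_trans a0)// xab.
- split.
  + move=> x /itvP xab; apply: derivableM => //; apply: drv.
    by rewrite (lt_le_trans a0)// xab.
  + by apply: cvgM; [exact: cvg_cst|apply/cvg_at_right_filter/cnt].
  + by apply: cvgM; [exact: cvg_cst|apply/cvg_at_left_filter/cnt].
- move=> x /itvP xab; have x0 : 0 < x by rewrite (lt_le_trans a0)// xab.
  rewrite derive1Ml; last exact: drv.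
  by rewrite powR_derive1 ?in_itv/= ?x0// mulrA mulVf// mul1r.
Qed.

Lemma integral_bigcup_le (F : (set R)^nat) (f : R -> \bar R) (M : \bar R) :
  nondecreasing_seq F -> (forall n, measurable (F n)) ->
  measurable_fun setT f -> (forall x, 0 <= f x)%E ->
  (forall n, \int[leb]_(x in F n) f x <= M)%E ->
  (\int[leb]_(x in \bigcup_n F n) f x <= M)%E.
Proof.
move=> ndF mF mf f0 FM.
have cvgF : (\int[leb]_(x in F n) f x @[n --> \oo] -->
    \int[leb]_(x in \bigcup_n F n) f x)%E.
  by apply: ge0_nondecreasing_set_cvg_integral => // i; exact: measurable_funTS.
rewrite -(cvg_lim _ cvgF)//; apply: lime_le.
  by apply/cvg_ex; eexists; exact: cvgF.
exact: nearW.
Qed.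

Lemma integral_pker_lty s c : 0 < s ->
  (\int[leb]_(t in `]0%R, c]) (pker s t)%:E < +oo)%E.
Proof.
move=> s0; have [c0|c0] := ltP 0 c; last first.
  by rewrite set_itv_ge ?integral_set0// bnd_simp -leNgt.
have mp : measurable_fun setT (EFin \o pker s).
  by apply/measurable_EFinP; exact: measurable_pker.
(* The denominator starts at 2, so that even the first interval is nondegenerate, as the
   antiderivative formula demands. *)
pose F n := `[c / n.+2%:R, c]%classic.
have mF n : measurable (F n) by exact: measurable_itv.
apply: (@le_lt_trans _ _ (c `^ s / s)%:E); last exact: ltry.
apply: (@le_trans _ _ (\int[leb]_(t in \bigcup_n F n) (pker s t)%:E)%E).
  apply: ge0_subset_integral => //.
  - exact: bigcupT_measurable.
  - exact: measurable_funTS.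
  - by move=> t _; rewrite lee_fin pker_ge0.
  - move=> t /=; rewrite in_itv/= => /andP[t0 tc].
    exists (Num.truncn (c / t)) => //; rewrite /F/= in_itv/= tc andbT.
    rewrite ler_pdivrMr// mulrC -ler_pdivrMr//.
    by rewrite (le_trans (ltW (truncnS_gt _)))// ler_nat.
apply: integral_bigcup_le => //.
- apply/nondecreasing_seqP => n; rewrite subsetEset; apply: subset_itvr.
  by rewrite bnd_simp ler_pM2l// lef_pV2 ?posrE// ler_nat.
- by move=> t; rewrite lee_fin pker_ge0.
move=> n; have cn0 : 0 < c / n.+2%:R by rewrite divr_gt0.
under eq_integral => t /[!inE]/= /itvP tF.
  rewrite /pker (lt_le_trans cn0) ?tF//.
  over.
rewrite integral_powR_itvcc ?gt_eqF//; last first.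
  by rewrite ltr_pdivrMr// ltr_pMr// ltr1n.
by rewrite lee_fin ler_pM2r ?invr_gt0// lerBlDr lerDl powR_ge0.
Qed.

Lemma integral_powR_ge1_lty q : q < 0 ->
  (\int[leb]_(t in `[1%R, +oo[) (t `^ (q - 1))%:E < +oo)%E.
Proof.
move=> q0; pose F n := `[1%R, n.+2%:R : R]%classic.
have mf : measurable_fun setT (fun t : R => (t `^ (q - 1))%:E).
  exact/measurable_EFinP.
apply: (@le_lt_trans _ _ (- q^-1)%:E); last exact: ltry.
have mF n : measurable (F n) by exact: measurable_itv.
apply: (@le_trans _ _ (\int[leb]_(t in \bigcup_n F n) (t `^ (q - 1))%:E)%E).
  apply: ge0_subset_integral => //.
  - exact: bigcupT_measurable.
  - exact: measurable_funTS.
  - by move=> t _; rewrite lee_fin powR_ge0.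
  - move=> t /=; rewrite in_itv/= andbT => t1.
    exists (Num.truncn t) => //; rewrite /F/= in_itv/= t1/=.
    by rewrite (le_trans (ltW (truncnS_gt _)))// ler_nat.
apply: integral_bigcup_le => //.
- apply/nondecreasing_seqP => n; rewrite subsetEset; apply: subset_itvl.
  by rewrite bnd_simp ler_nat.
- by move=> t; rewrite lee_fin powR_ge0.
move=> n; rewrite integral_powR_itvcc ?lt_eqF ?ltr1n//.
rewrite lee_fin powR1 mulrBl mul1r lerBlDr addNr.
by rewrite nmulr_lle0 ?powR_ge0// invr_lt0.
Qed.

(** The integrable singularity at the origin. Up to a factor it dominates the Beta, correlation and
    Gamma integrands near their singular points. *)
Let near0 s := pker s \_ `]0, 1].

Let near0E s t : 0 < t -> t <= 1 -> near0 s t = t `^ (s - 1).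
Proof.
move=> t0 t1; rewrite /near0 patchE mem_set; first by rewrite /pker t0.
by rewrite /= in_itv/= t0.
Qed.

Let near0_ge0 s t : 0 <= near0 s t.
Proof. by rewrite /near0 patchE; case: ifP => // _; exact: pker_ge0. Qed.

Let measurable_near0 s : measurable_fun setT (near0 s).
Proof.
apply/(measurable_restrictT _ _).1 => //; apply: measurable_funTS.
exact: measurable_pker.
Qed.

Let near0_lty s : 0 < s -> (\int[leb]_t (near0 s t)%:E < +oo)%E.
Proof.
move=> s0; have := integral_pker_lty 1 s0.
by rewrite integral_mkcond; under eq_integral do rewrite restrict_EFin.
Qed.

(** This gives the positivity of the Beta, correlation and Gamma constants. Finiteness matters:
    [fine] would send an infinite integral to 0. *)
Lemma Rintegral_gt0 (f : R -> R) (c : R) : measurable_fun setT f ->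
  (forall t, 0 <= f t) -> (\int[leb]_t (f t)%:E < +oo)%E ->
  0 < c -> (forall t, 0 < t < 1 -> c <= f t) -> 0 < \int[leb]_t f t.
Proof.
move=> mf f0 foo c0 cf; rewrite /Rintegral fine_gt0// foo andbT.
apply: (@lt_le_trans _ _ (\int[leb]_(t in `]0%R, 1%R[) c%:E)%E).
  by rewrite integral_cst// /= lebesgue_measure_itv/= lte_fin ltr01 oppr0 adde0
    mule1 lte_fin.
apply: (@le_trans _ _ (\int[leb]_(t in `]0%R, 1%R[) (f t)%:E)%E).
  apply: ge0_le_integral => //.
    by move=> t _; rewrite lee_fin ltW.
  by apply/measurable_EFinP; exact: measurable_funTS.
apply: ge0_subset_integral => //; first exact/measurable_EFinP.
by move=> t _; rewrite lee_fin.
Qed.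

(** The substitution [z = (x - y) t + y] takes out [(x - y)^(2 al - 1)] and leaves the Beta integral
    of [(1 - t)^(al-1) t^(al-1)] as [B]. For [x <= y] the two factors have disjoint supports. *)
Lemma beta_kernel (al : R) : 0 < al < 1 -> exists2 B : R, 0 < B &
  forall x y, (\int[leb]_z (pker al (x - z) * pker al (z - y))%:E =
               (B * pker (al + al) (x - y))%:E)%E.
Proof.
move=> /andP[al0 al1].
have al10 : al - 1 <= 0 by lra.
pose h (z : R) := pker al (1 - z) * pker al z.
have mh : measurable_fun setT h.
  apply: measurable_funM; last exact: measurable_pker.
  apply: measurableT_comp; first exact: measurable_pker.
  exact: measurable_funB.
have h0 z : 0 <= h z by rewrite mulr_ge0// pker_ge0.
have hoo : (\int[leb]_z (h z)%:E < +oo)%E.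
  (* On each half of the unit interval, [c] bounds the factor whose singularity sits at the far
     endpoint, at distance at least 1/2. *)
  pose c : R := 2^-1 `^ (al - 1).
  have mr : measurable_fun setT (fun z : R => near0 al (1 - z)).
    by apply: measurableT_comp => //; exact: measurable_funB.
  have mn := measurable_near0 al.
  have ms := measurable_funD mn mr.
  apply: (@le_lt_trans _ _
      (\int[leb]_z (c * (near0 al z + near0 al (1 - z)))%:E)%E).
    apply: ge0_le_integral => //.
    - by move=> z _; rewrite lee_fin.
    - exact/measurable_EFinP.
    - by apply/measurable_EFinP; exact: measurable_funM.
    move=> z _; rewrite lee_fin.
    have rhs0 : 0 <= c * (near0 al z + near0 al (1 - z)).
      by rewrite mulr_ge0 ?powR_ge0// addr_ge0.
    have [z0|z0] := ltP 0 z; last by rewrite /h /(pker _ z) ltNge z0 mulr0.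
    have [z1|z1] := ltP 0 (1 - z); last first.
      by rewrite /h /(pker _ (1 - z)) ltNge z1 mul0r.
    rewrite /h /pker z0 z1 !near0E//; [|lra|lra].
    rewrite mulrDr; have [zh|zh] := leP z 2^-1.
      apply: (@le_trans _ _ (c * z `^ (al - 1))).
        by rewrite ler_wpM2r ?powR_ge0// le0_ger_powR//; lra.
      by rewrite lerDl mulr_ge0// powR_ge0.
    apply: (@le_trans _ _ (c * (1 - z) `^ (al - 1))).
      by rewrite mulrC ler_wpM2r ?powR_ge0// le0_ger_powR//; lra.
    by rewrite lerDr mulr_ge0// powR_ge0.
  under eq_integral do rewrite EFinM.
  rewrite ge0_integralZl//=; last 3 first.
  - exact/measurable_EFinP.
  - by move=> z _; rewrite lee_fin addr_ge0.
  - by rewrite lee_fin powR_ge0.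
  under eq_integral do rewrite EFinD.
  rewrite ge0_integralD//=; last 4 first.
  - by move=> z _; rewrite lee_fin.
  - exact/measurable_EFinP.
  - by move=> z _; rewrite lee_fin.
  - exact/measurable_EFinP.
  rewrite lte_mul_pinfty// ?lee_fin ?powR_ge0// lte_add_pinfty//.
    exact: near0_lty.
  rewrite (@integral_reflect _ (fun z : R => (near0 al (1 - z))%:E))//; last first.
    exact/measurable_EFinP.
  rewrite preimage_setT; under eq_integral do rewrite opprK addrC.
  have := near0_lty al0.
  rewrite (@ge0_integral_affine _ (fun z : R => (near0 al z)%:E) 1 1)//.
  - rewrite mul1e; apply: le_lt_trans; rewrite le_eqVlt; apply/orP; left.
    by apply/eqP; apply: eq_integral => z _; rewrite mul1r.
  - exact/measurable_EFinP.
  - by move=> z; rewrite lee_fin.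
exists (\int[leb]_z h z).
  apply: (@Rintegral_gt0 _ 1) => // t /andP[t0 t1].
  rewrite /h /pker t0 subr_gt0 t1 -[leLHS]mulr1.
  by rewrite ler_pM// powR_ge1//; lra.
move=> x y; have [xy|xy] := ltP y x; last first.
  rewrite /(pker (al + al) _) subr_gt0 ltNge xy mulr0 integral0_eq// => z _.
  rewrite /pker !subr_gt0; case: ifPn => zx; last by rewrite mul0r.
  by rewrite ltNge (le_trans (ltW zx))// mulr0.
have t0 : 0 < x - y by rewrite subr_gt0.
have mg : measurable_fun setT (fun z : R => pker al (x - z) * pker al (z - y)).
  by apply: measurable_funM; apply: measurableT_comp;
    [exact: measurable_pker|exact: measurable_funB|
     exact: measurable_pker|exact: measurable_funB].
rewrite (@ge0_integral_affine _
  (fun z : R => (pker al (x - z) * pker al (z - y))%:E) (x - y) y)//; last 2 first.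
  exact/measurable_EFinP.
  by move=> z; rewrite lee_fin mulr_ge0// pker_ge0.
under eq_integral => z _.
  rewrite (_ : x - _ = (x - y) * (1 - z)); last by ring.
  rewrite addrK !pkerM// mulrACA EFinM.
  over.
rewrite ge0_integralZl//=; last 3 first.
- exact/measurable_EFinP.
- by move=> z _; rewrite lee_fin; exact: h0.
- by rewrite lee_fin mulr_ge0// powR_ge0.
rewrite -(@fineK _ (\int[leb]_z _)%E); last first.
  by rewrite ge0_fin_numE// integral_ge0// => z _; rewrite lee_fin; exact: h0.
rewrite -!EFinM; congr (_%:E); rewrite mulrA mulrC; congr (_ * _).
exact: pkerDD.
Qed.

(** For [y < x] the substitution [z = (x - y) t + x] leaves the integral of
    [t^(al-1) (t + 1)^(al-1)] over [t > 0] as the constant; exchanging the factors covers [x < y].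
    The integrand decays like [t^(2 al - 2)], so convergence at infinity uses [2 al < 1]. *)
Lemma correlation_kernel (al : R) : 0 < al -> al + al < 1 ->
  exists2 C : R, 0 < C &
  forall x y, x != y -> (\int[leb]_z (pker al (z - x) * pker al (z - y))%:E =
    (C * (pker (al + al) (x - y) + pker (al + al) (y - x)))%:E)%E.
Proof.
move=> al0 al1.
pose h (z : R) := pker al z * pker al (z + 1).
have mh : measurable_fun setT h.
  apply: measurable_funM; first exact: measurable_pker.
  apply: measurableT_comp; first exact: measurable_pker.
  exact: measurable_funD.
have h0 z : 0 <= h z by rewrite mulr_ge0// pker_ge0.
(* Majorant of the tail, from [(z + 1)^(al-1) <= z^(al-1)]; the exponent has the form [q - 1] with
   [q = al + al - 1 < 0]. *)
pose tl := (fun z : R => z `^ (al + al - 1 - 1)) \_ `[1, +oo[.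
have tl0 z : 0 <= tl z.
  by rewrite /tl patchE; case: ifP => // _; exact: powR_ge0.
have mtl : measurable_fun setT tl.
  by apply/(measurable_restrictT _ _).1 => //; apply: measurable_funTS.
have mn := measurable_near0 al.
have al10 : al - 1 <= 0 by lra.
have hoo : (\int[leb]_z (h z)%:E < +oo)%E.
  apply: (@le_lt_trans _ _ (\int[leb]_z ((near0 al z)%:E + (tl z)%:E))%E).
    apply: ge0_le_integral => //.
    - by move=> z _; rewrite lee_fin.
    - exact/measurable_EFinP.
    - by apply/measurable_EFinP; exact: measurable_funD.
    move=> z _; rewrite -EFinD lee_fin.
    have [z0|z0] := ltP 0 z; last first.
      by rewrite /h /(pker _ z) ltNge z0 mul0r addr_ge0.
    have z10 : 0 < z + 1 by lra.
    rewrite /h /pker z0 z10; have [z1|z1] := leP z 1.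
      rewrite near0E//; apply: (@le_trans _ _ (z `^ (al - 1))).
        rewrite ler_piMr ?powR_ge0//.
        have := @le0_ger_powR (al - 1) 1 (z + 1) al10; rewrite powR1; apply; lra.
      by rewrite lerDl.
    apply: (@le_trans _ _ (tl z)); last by rewrite lerDr.
    rewrite /tl patchE mem_set/=; last by rewrite in_itv/= andbT ltW.
    rewrite (_ : al + al - 1 - 1 = (al - 1) + (al - 1)); last by ring.
    rewrite (@gt0_powRD z (al - 1) (al - 1))// ler_wpM2l ?powR_ge0//.
    by rewrite le0_ger_powR//; lra.
  rewrite ge0_integralD//=; last 4 first.
  - by move=> z _; rewrite lee_fin.
  - exact/measurable_EFinP.
  - by move=> z _; rewrite lee_fin.
  - exact/measurable_EFinP.
  rewrite lte_add_pinfty//; first exact: near0_lty.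
  have := @integral_powR_ge1_lty (al + al - 1).
  rewrite integral_mkcond; under eq_integral do rewrite restrict_EFin.
  by apply; lra.
have main x y : y < x ->
    (\int[leb]_z (pker al (z - x) * pker al (z - y))%:E =
    ((\int[leb]_z h z) * pker (al + al) (x - y))%:E)%E.
  move=> xy; have t0 : 0 < x - y by rewrite subr_gt0.
  have mg : measurable_fun setT (fun z : R => pker al (z - x) * pker al (z - y)).
    by apply: measurable_funM; apply: measurableT_comp;
      [exact: measurable_pker|exact: measurable_funB|
     exact: measurable_pker|exact: measurable_funB].
  rewrite (@ge0_integral_affine _
    (fun z : R => (pker al (z - x) * pker al (z - y))%:E) (x - y) x)//; last 2 first.
    exact/measurable_EFinP.
    by move=> z; rewrite lee_fin mulr_ge0// pker_ge0.
  under eq_integral => z _.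
    rewrite addrK (_ : _ + x - y = (x - y) * (z + 1)); last by ring.
    rewrite !pkerM// mulrACA EFinM.
    over.
  rewrite ge0_integralZl//=; last 3 first.
  - exact/measurable_EFinP.
  - by move=> z _; rewrite lee_fin; exact: h0.
  - by rewrite lee_fin mulr_ge0// powR_ge0.
  rewrite -(@fineK _ (\int[leb]_z _)%E); last first.
    by rewrite ge0_fin_numE// integral_ge0// => z _; rewrite lee_fin; exact: h0.
  rewrite -!EFinM; congr (_%:E); rewrite mulrA mulrC; congr (_ * _).
  exact: pkerDD.
exists (\int[leb]_z h z).
  have c0 : 0 < 2 `^ (al - 1) :> R by rewrite powR_gt0.
  apply: (@Rintegral_gt0 _ (2 `^ (al - 1))) => // t /andP[t0 t1].
  rewrite /h /pker t0 ifT; last lra.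
  by rewrite -[leLHS]mul1r ler_pM ?powR_ge0 ?powR_ge1 ?le0_ger_powR//; lra.
move=> x y; rewrite neq_lt => /orP[xy|xy].
  under eq_integral do rewrite mulrC.
  rewrite main// [X in _ * (X + _)]/pker subr_gt0 ltNge (ltW xy)/=.
  by rewrite add0r.
by rewrite main// [X in _ * (_ + X)]/pker subr_gt0 ltNge (ltW xy)/= addr0.
Qed.

(** [Gamma] takes [fine] of an integral, so convergence has to be proved first: the integrand is
    dominated by the power up to 1 and by the exponential density beyond. *)
Lemma Gamma_gt0 s : 0 < s < 1 -> 0 < Gamma s.
Proof.
move=> /andP[s0 s1]; rewrite /Gamma Rintegral_mkcond.
pose h : R -> R := (fun t : R => t `^ (s - 1) * expR (- t)) \_ `]0, +oo[.
have h0 t : 0 <= h t.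
  by rewrite /h patchE; case: ifP => // _; rewrite mulr_ge0 ?powR_ge0 ?expR_ge0.
have mh : measurable_fun setT h.
  apply/(measurable_restrictT _ _).1 => //; apply: measurable_funTS.
  apply: measurable_funM => //; apply: measurableT_comp => //.
have mn := measurable_near0 s.
have me := @measurable_exponential_pdf R 1.
have e0 t : 0 <= exponential_pdf (1 : R) t by exact: exponential_pdf_ge0.
change (0 < \int[leb]_t h t).
apply: (@Rintegral_gt0 _ (expR (- 1))) => //; last first.
  move=> t /andP[t0 t1]; rewrite /h patchE mem_set/=; last first.
    by rewrite in_itv/= t0.
  rewrite -[leLHS]mul1r ler_pM ?expR_ge0//; last by rewrite ler_expR; lra.
  by rewrite powR_ge1//; lra.
apply: (@le_lt_trans _ _
    (\int[leb]_z ((near0 s z)%:E + (exponential_pdf 1 z)%:E))%E).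
  apply: ge0_le_integral => //.
  - by move=> z _; rewrite lee_fin.
  - exact/measurable_EFinP.
  - by apply/measurable_EFinP; exact: measurable_funD.
  move=> z _; rewrite -EFinD lee_fin {1}/h patchE.
  case: ifPn => [|_]; last by rewrite addr_ge0.
  rewrite inE/= in_itv/= andbT => z0; have [z1|z1] := leP z 1.
    apply: (@le_trans _ _ (near0 s z)); last by rewrite lerDl.
    by rewrite near0E// ler_piMr ?powR_ge0// -expR0 ler_expR; lra.
  apply: (@le_trans _ _ (exponential_pdf 1 z)); last by rewrite lerDr.
  rewrite exponential_pdfE; last exact: ltW.
  rewrite mul1r mulN1r.
  rewrite ler_piMl ?expR_ge0//.
  have := @le0_ger_powR (s - 1) 1 z; rewrite powR1; apply; lra.
rewrite ge0_integralD//=; last 4 first.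
- by move=> z _; rewrite lee_fin.
- exact/measurable_EFinP.
- by move=> z _; rewrite lee_fin.
- exact/measurable_EFinP.
by rewrite integral_exponential_pdf// lte_add_pinfty ?ltry//; exact: near0_lty.
Qed.

End power_kernel.

(** * Riemann-Liouville operators on the line *)

Section fractional_operators.
Context {R : realType}.
Local Notation leb := (@lebesgue_measure R).
Implicit Types (s a b x y z : R) (u v w : R -> R).

(** The left Riemann-Liouville integral of order [s] without the factor [1 / Gamma s]; [Rop] is its
    transpose. *)
Definition Lop s v x : R := \int[leb]_y (pker s (x - y) * v y).

Definition Rop s v x : R := \int[leb]_y (pker s (y - x) * v y).

(** Vanishing off the interval is required at every point, so that integrals over the line can be
    cut down by pointwise rewriting. *)
Definition supported_L2 a b v := [/\ measurable_fun setT v,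
  forall x, ~ (a < x < b) -> v x = 0 & (\int[leb]_x ((v x) ^+ 2)%:E < +oo)%E].

Lemma measurable_pkerB s :
  measurable_fun setT (fun p : R * R => pker s (p.1 - p.2)).
Proof.
apply: measurableT_comp; first exact: measurable_pker.
exact: measurable_funB.
Qed.

Lemma measurable_pkerBC s :
  measurable_fun setT (fun p : R * R => pker s (p.2 - p.1)).
Proof.
apply: measurableT_comp; first exact: measurable_pker.
exact: measurable_funB.
Qed.

Lemma measurable_Lop s v : measurable_fun setT v -> measurable_fun setT (Lop s v).
Proof.
move=> mv.
apply: (@measurable_Rintegral_sec _ _ _ _ _ leb
  (fun x y : R => pker s (x - y) * v y)).
apply: measurable_funM; first exact: measurable_pkerB.
exact: measurableT_comp mv measurable_snd.
Qed.

Lemma measurable_Rop s v : measurable_fun setT v -> measurable_fun setT (Rop s v).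
Proof.
move=> mv.
apply: (@measurable_Rintegral_sec _ _ _ _ _ leb
  (fun x y : R => pker s (y - x) * v y)).
apply: measurable_funM; first exact: measurable_pkerBC.
exact: measurableT_comp mv measurable_snd.
Qed.

Lemma ge0_integral_translation (f : R -> \bar R) x : measurable_fun setT f ->
  (forall t, 0 <= f t)%E ->
  (\int[leb]_y f (y + x)%R = \int[leb]_y f y)%E.
Proof.
move=> mf f0; rewrite [RHS](@ge0_integral_affine _ _ 1 x)// mul1e.
by apply: eq_integral => y _; rewrite mul1r.
Qed.

Lemma ge0_integral_subl (f : R -> \bar R) x : measurable_fun setT f ->
  (forall t, 0 <= f t)%E ->
  (\int[leb]_y f (x - y)%R = \int[leb]_y f y)%E.
Proof.
move=> mf f0; rewrite integral_reflect//; last first.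
  by apply: measurableT_comp => //; exact: measurable_funB.
rewrite preimage_setT -[RHS](ge0_integral_translation x)//.
by apply: eq_integral => y _; rewrite opprK addrC.
Qed.

(* Schur's test: on a bounded interval the kernel may be truncated, hence is
   integrable, and [|w x| |v y| <= w x ^ 2 + v y ^ 2]. *)
Lemma pker_form_lty s a b v w : 0 < s ->
  supported_L2 a b v -> supported_L2 a b w ->
  (\int[leb]_x (`|w x|%:E * \int[leb]_y (pker s (x - y) * `|v y|)%:E) < +oo)%E.
Proof.
move=> s0 [mv v0 voo] [mw w0 woo].
pose kap : R -> R := (pker s) \_ `]0, (b - a)].
have kap0 t : 0 <= kap t.
  by rewrite /kap patchE; case: ifP => // _; exact: pker_ge0.
have mkap : measurable_fun setT kap.
  apply/(measurable_restrictT _ _).1 => //; apply: measurable_funTS.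
  exact: measurable_pker.
have kapoo : (\int[leb]_t (kap t)%:E < +oo)%E.
  have := integral_pker_lty (b - a) s0.
  by rewrite integral_mkcond; under eq_integral do rewrite restrict_EFin.
have kapint0 : (0 <= \int[leb]_t (kap t)%:E)%E.
  by apply: integral_ge0 => t _; rewrite lee_fin.
have mEkap : measurable_fun setT (EFin \o kap) by exact/measurable_EFinP.
have mkapr x : measurable_fun setT (fun y => (EFin \o kap) (x - y)).
  by apply: (measurableT_comp mEkap); exact: measurable_funB.
have mkapl y : measurable_fun setT (fun x => (EFin \o kap) (x - y)).
  by apply: (measurableT_comp mEkap); exact: measurable_funB.
have mkapB : measurable_fun setT (fun p : R * R => kap (p.1 - p.2)).
  by apply: measurableT_comp => //; exact: measurable_funB.
have mw2 : measurable_fun setT (fun x => w x ^+ 2) by exact: measurable_funX.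
have mv2 : measurable_fun setT (fun x => v x ^+ 2) by exact: measurable_funX.
have mk1 : measurable_fun setT (fun p : R * R => (kap (p.1 - p.2) * w p.1 ^+ 2)%:E).
  apply/measurable_EFinP; apply: measurable_funM => //.
  exact: measurableT_comp mw2 measurable_fst.
have mk2 : measurable_fun setT (fun p : R * R => (kap (p.1 - p.2) * v p.2 ^+ 2)%:E).
  apply/measurable_EFinP; apply: measurable_funM => //.
  exact: measurableT_comp mv2 measurable_snd.
have mi1 := @measurable_integral_sec _ _ _ _ _ leb
  (fun x y : R => (kap (x - y) * w x ^+ 2)%:E) mk1.
have mi2 := @measurable_integral_sec _ _ _ _ _ leb
  (fun x y : R => (kap (x - y) * v y ^+ 2)%:E) mk2.
have i10 x : (0 <= \int[leb]_y (kap (x - y) * w x ^+ 2)%:E)%E.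
  by apply: integral_ge0 => y _; rewrite lee_fin mulr_ge0// sqr_ge0.
have i20 x : (0 <= \int[leb]_y (kap (x - y) * v y ^+ 2)%:E)%E.
  by apply: integral_ge0 => y _; rewrite lee_fin mulr_ge0// sqr_ge0.
have e1 : (\int[leb]_x \int[leb]_y (kap (x - y) * w x ^+ 2)%:E =
    \int[leb]_t (kap t)%:E * \int[leb]_x (w x ^+ 2)%:E)%E.
  rewrite -ge0_integralZl//=; last 2 first.
    exact/measurable_EFinP.
    by move=> x _; rewrite lee_fin sqr_ge0.
  apply: eq_integral => x _; rewrite -(@ge0_integral_subl (EFin \o kap) x)//.
  rewrite -(ge0_integralZr leb measurableT (mkapr x))//.
    by move=> z _; rewrite lee_fin.
  by rewrite lee_fin sqr_ge0.
have e2 : (\int[leb]_x \int[leb]_y (kap (x - y) * v y ^+ 2)%:E =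
    \int[leb]_t (kap t)%:E * \int[leb]_x (v x ^+ 2)%:E)%E.
  rewrite (@tonelli _ _ _ _ _ leb leb
    (fun x y : R => (kap (x - y) * v y ^+ 2)%:E))//; last first.
    by move=> x y; rewrite lee_fin mulr_ge0// sqr_ge0.
  rewrite -ge0_integralZl//=; last 2 first.
    exact/measurable_EFinP.
    by move=> x _; rewrite lee_fin sqr_ge0.
  apply: eq_integral => y _.
  rewrite -(@ge0_integral_translation (EFin \o kap) (- y))//.
  rewrite -(ge0_integralZr leb measurableT (mkapl y))//.
    by move=> z _; rewrite lee_fin.
  by rewrite lee_fin sqr_ge0.
apply: (@le_lt_trans _ _ (\int[leb]_x
    (\int[leb]_y (kap (x - y) * w x ^+ 2)%:E +
     \int[leb]_y (kap (x - y) * v y ^+ 2)%:E))%E); last first.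
  rewrite ge0_integralD//= e1 e2 lte_add_pinfty// lte_mul_pinfty//;
    by rewrite ge0_fin_numE.
apply: ge0_le_integral => //=.
- move=> x _; rewrite mule_ge0//; apply: integral_ge0 => y _.
  by rewrite lee_fin mulr_ge0// pker_ge0.
- apply: emeasurable_funM.
    by apply/measurable_EFinP; exact: measurableT_comp.
  apply: (@measurable_integral_sec _ _ _ _ _ leb
    (fun x y : R => (pker s (x - y) * `|v y|)%:E)).
  apply/measurable_EFinP; apply: measurable_funM; first exact: measurable_pkerB.
  apply: measurableT_comp => //; exact: measurableT_comp mv measurable_snd.
- exact: emeasurable_funD.
move=> x _; rewrite -ge0_integralZl//=; last 2 first.
- apply/measurable_EFinP; apply: measurable_funM; last exact: measurableT_comp.
  apply: measurableT_comp; first exact: measurable_pker.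
  exact: measurable_funB.
- by move=> y _; rewrite lee_fin mulr_ge0// pker_ge0.
rewrite -ge0_integralD//=; last 4 first.
- by move=> y _; rewrite lee_fin mulr_ge0// sqr_ge0.
- apply/measurable_EFinP; apply: measurable_funM => //.
  by apply: measurableT_comp => //; exact: measurable_funB.
- by move=> y _; rewrite lee_fin mulr_ge0// sqr_ge0.
- apply/measurable_EFinP; apply: measurable_funM => //.
  by apply: measurableT_comp => //; exact: measurable_funB.
apply: ge0_le_integral => //=.
- by move=> y _; rewrite lee_fin !mulr_ge0// pker_ge0.
- apply/measurable_EFinP; apply: measurable_funM => //.
  apply: measurable_funM; last exact: measurableT_comp.
  apply: measurableT_comp; first exact: measurable_pker.
  exact: measurable_funB.
- apply/measurable_EFinP; apply: measurable_funD; apply: measurable_funM => //;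
    by apply: measurableT_comp => //; exact: measurable_funB.
move=> y _; rewrite -EFinD lee_fin.
have rhs0 : 0 <= kap (x - y) * w x ^+ 2 + kap (x - y) * v y ^+ 2.
  by rewrite addr_ge0// mulr_ge0// sqr_ge0.
have [/andP[ax xb]|xab] := pselect (a < x < b); last first.
  by rewrite [in leLHS](w0 _ xab) normr0 mul0r.
have [/andP[ay yb]|yab] := pselect (a < y < b); last first.
  by rewrite [in leLHS](v0 _ yab) normr0 !mulr0.
have [yx|yx] := ltP y x; last first.
  by rewrite /(pker s) subr_gt0 ltNge yx mul0r mulr0.
have -> : kap (x - y) = pker s (x - y).
  by rewrite /kap patchE mem_set//= in_itv/= subr_gt0 yx/=; lra.
rewrite mulrCA -mulrDr ler_wpM2l ?pker_ge0//.
rewrite -(real_normK (num_real (w x))) -(real_normK (num_real (v y))).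
have : 0 <= (`|w x| - `|v y|) ^+ 2 by exact: sqr_ge0.
have : 0 <= `|w x| * `|v y| by rewrite mulr_ge0.
rewrite sqrrB; lra.
Qed.

End fractional_operators.

(** * Energy identities for the operators on the line *)

Section energy_identities.
Context {R : realType}.
Local Notation leb := (@lebesgue_measure R).
Implicit Types (s a b x y z : R) (u v w : R -> R).

Lemma measurable_pker_sec s x v : measurable_fun setT v ->
  measurable_fun setT (fun y => pker s (x - y) * v y).
Proof.
move=> mv; apply: measurable_funM => //; apply: measurableT_comp.
  exact: measurable_pker.
exact: measurable_funB.
Qed.

Lemma measurable_pkerC_sec s x v : measurable_fun setT v ->
  measurable_fun setT (fun y => pker s (y - x) * v y).
Proof.
move=> mv; apply: measurable_funM => //; apply: measurableT_comp.
  exact: measurable_pker.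
exact: measurable_funB.
Qed.

Lemma measurable_pker_form s v w : measurable_fun setT v ->
  measurable_fun setT w ->
  measurable_fun setT (fun p : R * R => w p.1 * (pker s (p.1 - p.2) * v p.2)).
Proof.
move=> mv mw; apply: measurable_funM.
  exact: measurableT_comp mw measurable_fst.
apply: measurable_funM; first exact: measurable_pkerB.
exact: measurableT_comp mv measurable_snd.
Qed.

Lemma measurable_pkerC_form s v w : measurable_fun setT v ->
  measurable_fun setT w ->
  measurable_fun setT (fun p : R * R => w p.1 * (pker s (p.2 - p.1) * v p.2)).
Proof.
move=> mv mw; apply: measurable_funM.
  exact: measurableT_comp mw measurable_fst.
apply: measurable_funM; first exact: measurable_pkerBC.
exact: measurableT_comp mv measurable_snd.
Qed.

Lemma integral_form_abs (k : R -> R -> R) v w :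
  (forall x, measurable_fun setT (k x)) -> (forall x y, 0 <= k x y) ->
  measurable_fun setT v ->
  (\int[leb]_x (`|w x|%:E * \int[leb]_y (k x y * `|v y|)%:E) =
   \int[leb]_x \int[leb]_y `|w x * (k x y * v y)|%:E)%E.
Proof.
move=> mk k0 mv; apply: eq_integral => x _.
have mkv : measurable_fun setT (fun y => (k x y * `|v y|)%:E).
  apply/measurable_EFinP; apply: measurable_funM; first exact: mk.
  exact: measurableT_comp.
rewrite -(ge0_integralZl leb measurableT mkv)//.
- by apply: eq_integral => y _; rewrite -EFinM !normrM (ger0_norm (k0 _ _)).
- by move=> y _; rewrite lee_fin mulr_ge0.
Qed.

Lemma integrable_form s a b v w : 0 < s ->
  supported_L2 a b v -> supported_L2 a b w ->
  (leb \x leb)%E.-integrable setT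
    (fun p : R * R => (w p.1 * (pker s (p.1 - p.2) * v p.2))%:E).
Proof.
move=> s0 Sv Sw; have [mv _ _] := Sv; have [mw _ _] := Sw.
apply/(@integrable12ltyP _ _ _ _ _ leb leb).
  by apply/measurable_EFinP; exact: measurable_pker_form.
have := pker_form_lty s0 Sv Sw.
rewrite (@integral_form_abs (fun x y => pker s (x - y)))//.
- move=> x; apply: measurableT_comp; first exact: measurable_pker.
  exact: measurable_funB.
- by move=> x y; exact: pker_ge0.
Qed.

(** The transposed kernel gives the previous form with [v] and [w] exchanged, so the double integral
    is taken in the other order. *)
Lemma integrable_formC s a b v w : 0 < s ->
  supported_L2 a b v -> supported_L2 a b w ->
  (leb \x leb)%E.-integrable setT
    (fun p : R * R => (w p.1 * (pker s (p.2 - p.1) * v p.2))%:E).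
Proof.
move=> s0 Sv Sw; have [mv _ _] := Sv; have [mw _ _] := Sw.
apply/(@integrable21ltyP _ _ _ _ _ leb leb).
  by apply/measurable_EFinP; exact: measurable_pkerC_form.
have := pker_form_lty s0 Sw Sv.
rewrite (@integral_form_abs (fun x y => pker s (x - y)))//.
- apply: le_lt_trans; rewrite le_eqVlt; apply/orP; left; apply/eqP.
  apply: eq_integral => y _; apply: eq_integral => x _ /=.
  by rewrite mulrA mulrC (mulrC (w x)).
- move=> x; apply: measurableT_comp; first exact: measurable_pker.
  exact: measurable_funB.
- by move=> x y; exact: pker_ge0.
Qed.

Lemma integrable_form_lty (k : R -> R -> R) v w :
  (leb \x leb)%E.-integrable setT
    (fun p : R * R => (w p.1 * (k p.1 p.2 * v p.2))%:E) ->
  (\int[leb]_x \int[leb]_y `|w x * (k x y * v y)|%:E < +oo)%E.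
Proof.
move=> ki; have mk := measurable_int _ ki.
exact: (integrable12ltyP leb leb mk).1.
Qed.

Lemma Lop_adjoint s a b v w : 0 < s -> supported_L2 a b v ->
  supported_L2 a b w ->
  \int[leb]_x (w x * Lop s v x) = \int[leb]_y (v y * Rop s w y).
Proof.
move=> s0 Sv Sw; have [mv _ _] := Sv; have [mw _ _] := Sw.
transitivity (\int[leb]_x \int[leb]_y (w x * (pker s (x - y) * v y))).
  apply: eq_Rintegral => x _; rewrite RintegralZl_measurable//.
  exact: measurable_pker_sec.
rewrite (@Rintegral_fubini _ _ _ _ _ leb leb
  (fun x y : R => w x * (pker s (x - y) * v y))).
- apply: eq_Rintegral => y _; rewrite -RintegralZl_measurable.
  + by apply: eq_Rintegral => x _; rewrite mulrA mulrC (mulrC (w x)).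
  + exact: measurable_pkerC_sec.
- exact: measurable_pker_form.
- exact: (@integrable_form_lty (fun x y => pker s (x - y)) _ _
    (integrable_form s0 Sv Sw)).
Qed.

Lemma integrable_mul_Lop s a b v w : 0 < s -> supported_L2 a b v ->
  supported_L2 a b w ->
  leb.-integrable setT (EFin \o (fun x => w x * Lop s v x)).
Proof.
move=> s0 Sv Sw; have [mv _ _] := Sv; have [mw _ _] := Sw.
have := @integrable_Rintegral_sec _ _ _ _ _ leb leb
  (fun x y : R => w x * (pker s (x - y) * v y))
  (measurable_pker_form s mv mw)
  (@integrable_form_lty (fun x y => pker s (x - y)) _ _ (integrable_form s0 Sv Sw)).
congr (_.-integrable _ _); apply/funext => x /=; congr (_%:E).
by rewrite RintegralZl_measurable//; exact: measurable_pker_sec.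
Qed.

(** [(R w, L v) = (w, L L v)] by transposition, and the Beta integral makes [L L] equal to [B] times
    the operator of order [al + al]. *)
Lemma Lop_Rop_energy (al a b : R) : 0 < al < 1 -> exists2 B : R, 0 < B &
  forall v w, supported_L2 a b v -> supported_L2 a b w ->
  \int[leb]_z (Rop al w z * Lop al v z) =
  B * \int[leb]_x (w x * Lop (al + al) v x).
Proof.
move=> al01; have [B B0 HB] := beta_kernel al01; exists B => // v w Sv Sw.
have al2 : 0 < al + al by lra.
have [mv _ _] := Sv; have [mw _ _] := Sw.
rewrite (@gram_Rintegral _ _ _ _ _ _ _ leb leb leb
  (fun z x : R => pker al (x - z)) (fun z y : R => pker al (z - y))
  (fun x y : R => B * pker (al + al) (x - y)))//.
- rewrite -RintegralZl_measurable; last first.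
    by apply: measurable_funM => //; exact: measurable_Lop.
  apply: eq_Rintegral => x _; rewrite mulrCA; congr (_ * _).
  under eq_Rintegral do rewrite -mulrA.
  by rewrite RintegralZl_measurable//; exact: measurable_pker_sec.
- exact: measurable_pkerBC.
- exact: measurable_pkerB.
- by apply: measurable_funM => //; exact: measurable_pkerB.
- by move=> z x; exact: pker_ge0.
- by move=> z x; exact: pker_ge0.
- by move=> x y; rewrite mulr_ge0 ?pker_ge0// ltW.
- by move=> x; apply: aeW => y; exact: HB.
- rewrite (@integral_form_abs (fun x y => B * pker (al + al) (x - y)))//.
  + apply: integrable_form_lty.
    have := integrableZl measurableT B (integrable_form al2 Sv Sw).
    congr (_.-integrable _ _); apply/funext => p /=.
    by rewrite -EFinM; congr (_%:E); ring.
  + move=> x; apply: measurable_funM => //; apply: measurableT_comp.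
      exact: measurable_pker.
    exact: measurable_funB.
  + by move=> x y; rewrite mulr_ge0 ?pker_ge0// ltW.
Qed.

(** [(L v, L v) = (v, K v)] with [K] the symmetric correlation kernel. Its two one-sided halves are
    transposes of each other, hence contribute equally to the quadratic form: this is the 2 in the
    witness. *)
Lemma Lop_energy (al a b : R) : 0 < al -> al + al < 1 -> exists2 C : R, 0 < C &
  forall v, supported_L2 a b v ->
  leb.-integrable setT (EFin \o (fun z => Lop al v z ^+ 2)) /\
  \int[leb]_z (Lop al v z ^+ 2) = C * \int[leb]_x (v x * Lop (al + al) v x).
Proof.
move=> al0 al1; have [C C0 HC] := correlation_kernel al0 al1.
exists (C * 2); first by rewrite mulr_gt0.
move=> v Sv; have [mv _ _] := Sv.
have al2 : 0 < al + al by lra.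
pose k x y : R := pker (al + al) (x - y) + pker (al + al) (y - x).
have mk : measurable_fun setT (fun p : R * R => k p.1 p.2).
  by apply: measurable_funD; [exact: measurable_pkerB|exact: measurable_pkerBC].
have k0 x y : 0 <= k x y by rewrite addr_ge0// pker_ge0.
have mCk : measurable_fun setT (fun p : R * R => C * k p.1 p.2).
  exact: measurable_funM.
have Ck0 x y : 0 <= C * k x y by rewrite mulr_ge0// ltW.
have mp : measurable_fun setT (fun p : R * R => pker al (p.1 - p.2)).
  exact: measurable_pkerB.
have p0 (z x : R) : 0 <= pker al (z - x) by exact: pker_ge0.
(* The only exceptional [y] is [x] itself, where the correlation integral diverges; a point is a
   null set. *)
have kE (x : measurableTypeR R) : {ae leb, forall y,
    (\int[leb]_z (pker al (z - x) * pker al (z - y))%:E = (C * k x y)%:E)%E}.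
  exists [set x]; split; [exact: measurable_set1|exact: lebesgue_measure_set1|].
  by move=> y /= Hy; apply/eqP/negPn/negP => yx; apply: Hy; apply: HC;
    rewrite eq_sym.
have koo : (\int[leb]_x (`|v x|%:E * \int[leb]_y (C * k x y * `|v y|)%:E) < +oo)%E.
  rewrite (@integral_form_abs (fun x y => C * k x y))//.
  - apply: integrable_form_lty.
    have := integrableZl measurableT C (integrableD measurableT
      (integrable_form al2 Sv Sv) (integrable_formC al2 Sv Sv)).
    congr (_.-integrable _ _); apply/funext => p /=.
    by rewrite -EFinD -EFinM /k; congr (_%:E); ring.
  - by move=> x; exact: (@measurable_sec1 _ _ _ _ _ (fun x y => C * k x y)).
split.
  have := @gram_integrable _ _ _ _ _ _ _ leb leb leb
    (fun z x : R => pker al (z - x)) (fun z y : R => pker al (z - y))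
    (fun x y : R => C * k x y) mp mp mCk p0 p0 Ck0 kE v v mv mv koo.
  by congr (_.-integrable _ _); apply/funext => z /=; rewrite expr2.
have := @gram_Rintegral _ _ _ _ _ _ _ leb leb leb
  (fun z x : R => pker al (z - x)) (fun z y : R => pker al (z - y))
  (fun x y : R => C * k x y) mp mp mCk p0 p0 Ck0 kE v v mv mv koo.
under eq_Rintegral do rewrite -expr2.
move=> ->.
have mLv := measurable_Lop (al + al) mv.
have mRv := measurable_Rop (al + al) mv.
have mkv : measurable_fun setT (fun p : R * R => k p.1 p.2 * v p.2).
  apply: measurable_funM => //; exact: measurableT_comp mv measurable_snd.
transitivity (C * \int[leb]_x \int[leb]_y
    (v x * (pker (al + al) (x - y) * v y) + v x * (pker (al + al) (y - x) * v y))).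
  rewrite -RintegralZl_measurable; last first.
    apply: (@measurable_Rintegral_sec _ _ _ _ _ leb (fun x y =>
      v x * (pker (al + al) (x - y) * v y) + v x * (pker (al + al) (y - x) * v y))).
    by apply: measurable_funD;
      [exact: measurable_pker_form|exact: measurable_pkerC_form].
  apply: eq_Rintegral => x _.
  have mkx : measurable_fun setT (fun y => k x y * v y).
    exact: (@measurable_sec1 _ _ _ _ _ (fun x y => k x y * v y)).
  under eq_Rintegral do rewrite -mulrA.
  rewrite RintegralZl_measurable// mulrCA; congr (_ * _).
  rewrite -RintegralZl_measurable//.
  by apply: eq_Rintegral => y _; rewrite /k mulrDl mulrDr.
rewrite -mulrA; congr (_ * _); rewrite (@Rintegral2D _ _ _ _ _ leb leb
  (fun x y => v x * (pker (al + al) (x - y) * v y))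
  (fun x y => v x * (pker (al + al) (y - x) * v y))).
- rewrite mulrDl !mul1r; congr (_ + _).
  + apply: eq_Rintegral => x _; rewrite RintegralZl_measurable//.
    exact: measurable_pker_sec.
  + rewrite (Lop_adjoint al2 Sv Sv).
    apply: eq_Rintegral => x _; rewrite RintegralZl_measurable//.
    exact: measurable_pkerC_sec.
- exact: measurable_pker_form.
- exact: measurable_pkerC_form.
- exact: (@integrable_form_lty (fun x y => pker (al + al) (x - y)) _ _
    (integrable_form al2 Sv Sv)).
- exact: (@integrable_form_lty (fun x y => pker (al + al) (y - x)) _ _
    (integrable_formC al2 Sv Sv)).
Qed.

End energy_identities.

(** * Weighted energy *)

Section weighted_energy.
Context {R : realType}.
Local Notation leb := (@lebesgue_measure R).
Implicit Types (s a b x y z e : R) (u v w h : R -> R).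

Lemma derive1_expRN e z :
  (fun x : R => - expR (- e * x))^`()%classic z = e * expR (- e * z).
Proof.
rewrite derive1_comp// derive1N// derive1_id mulN1r derive1_comp// derive1E.
have /funeqP -> := @derive_expR R.
by rewrite derive1Ml// derive1_id mulr1 mulrN opprK mulrC.
Qed.

Lemma integral_expRN e x b : x < b ->
  (\int[leb]_(z in `]x, b[) (e * expR (- e * z))%:E =
   (expR (- e * x) - expR (- e * b))%:E)%E.
Proof.
move=> xb.
have cexp : continuous (fun z : R => expR (- e * z)).
  move=> z; apply: continuous_comp; last exact: continuous_expR.
  by apply: continuousM => //; exact: cst_continuous.
have cf : continuous (fun z : R => e * expR (- e * z)).
  move=> z; apply: (@continuousM _ R^o (fun=> e) (fun z => expR (- e * z))).
    exact: cst_continuous.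
  exact: cexp.
have mf : measurable_fun setT (fun z : R => (e * expR (- e * z))%:E).
  by apply/measurable_EFinP; exact: continuous_measurable_fun.
rewrite integral_itv_bndo_bndc; last exact: measurable_funTS.
rewrite integral_itv_obnd_cbnd; last exact: measurable_funTS.
rewrite (@continuous_FTC2 _ _ (fun z => - expR (- e * z)))//.
- by rewrite -EFinB; congr (_%:E); ring.
- by apply: continuous_subspaceT => z; exact: cf.
- split.
  + by move=> z _; exact: ex_derive.
  + by apply/cvg_at_right_filter; apply: cvgN; exact: cexp.
  + by apply/cvg_at_left_filter; apply: cvgN; exact: cexp.
- by move=> z _; exact: derive1_expRN.
Qed.

(* Summation by parts: [expR (- e * x) - expR (- e * b)] is a superposition of
   indicators of half-lines [x < z] with nonnegative weights. *)
Lemma le_Rintegral_expRN e a b h : 0 <= e ->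
  leb.-integrable setT (EFin \o h) ->
  (forall x, ~ (a < x < b) -> h x = 0) ->
  (forall z, 0 <= \int[leb]_x (if x < z then h x else 0)) ->
  expR (- e * b) * \int[leb]_x h x <= \int[leb]_x (expR (- e * x) * h x).
Proof.
move=> e0 ih h0 H0; have mh : measurable_fun setT h.
  by apply/measurable_EFinP; exact: measurable_int ih.
(* Density of the decreasing weight, cut to the interval: for [x] inside, its integral over [z > x]
   is [expR (- e * x) - expR (- e * b)]. *)
pose g : R -> R := (fun z => e * expR (- e * z)) \_ `]a, b[.
have g0 z : 0 <= g z.
  by rewrite /g patchE; case: ifP => // _; rewrite mulr_ge0// expR_ge0.
have mexp : measurable_fun setT (fun z : R => expR (- e * z)).
  by apply: measurableT_comp => //; exact: measurable_funM.
have mg : measurable_fun setT g.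
  apply/(measurable_restrictT _ _).1 => //; apply: measurable_funTS.
  exact: measurable_funM.
pose k x z : R := if x < z then h x * g z else 0.
have mk : measurable_fun setT (fun p : R * R => k p.1 p.2).
  apply: measurable_fun_ifT => //; first exact: measurable_fun_ltr.
  apply: measurable_funM; first exact: measurableT_comp mh measurable_fst.
  exact: measurableT_comp mg measurable_snd.
have kx x : a < x < b -> (\int[leb]_z (if x < z then g z else 0)%:E =
    (expR (- e * x) - expR (- e * b))%:E)%E.
  move=> /andP[ax xb]; rewrite -integral_expRN// [RHS]integral_mkcond.
  apply: eq_integral => z _; rewrite /= patchE /g patchE.
  rewrite !mem_setE !in_itv/=.
  case: (ltP x z) => //= xz; rewrite (lt_trans ax xz)/=.
  by case: ifP.
have gx0 x z : 0 <= (if x < z then g z else 0) by case: ifP.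
have mgx x : measurable_fun setT (fun z => if x < z then g z else 0).
  by apply: measurable_fun_ifT => //; exact: measurable_fun_ltr.
have kxE x z : k x z = h x * (if x < z then g z else 0).
  by rewrite /k; case: ifP => // _; rewrite mulr0.
have iwh : leb.-integrable setT (EFin \o (fun x => expR (- e * x) * h x)).
  have := integrableZl measurableT (expR (- e * a)) ih.
  apply: le_integrable => //.
  - by apply/measurable_EFinP; exact: measurable_funM.
  - move=> x _ /=; rewrite lee_fin !normrM.
    rewrite !(ger0_norm (expR_ge0 _)).
    have [/andP[ax _]|/h0 ->] := pselect (a < x < b); last by rewrite normr0 !mulr0.
    by rewrite ler_wpM2r// ler_expR !mulNr lerN2 ler_wpM2l// ltW.
have ibh : leb.-integrable setT (EFin \o (fun x => expR (- e * b) * h x)).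
  have := integrableZl measurableT (expR (- e * b)) ih.
  by congr (_.-integrable _ _).
have hkE x : \int[leb]_z k x z = expR (- e * x) * h x - expR (- e * b) * h x.
  under eq_Rintegral do rewrite kxE.
  rewrite RintegralZl_measurable; last exact: mgx.
  have [axb|/h0 ->] := pselect (a < x < b); last by rewrite mul0r !mulr0 subrr.
  by rewrite /Rintegral kx//= -mulrBl mulrC.
rewrite -subr_ge0 -RintegralZl//.
rewrite -RintegralB//; under eq_Rintegral do rewrite -hkE.
(* Integrating first in [x] leaves, for each [z], the partial integral of [h] over [x < z] times
   [g z], both nonnegative. *)
rewrite (@Rintegral_fubini _ _ _ _ _ leb leb k)//.
  apply: Rintegral_ge0 => z _; rewrite (_ : (fun x => k x z) =
      (fun x => (if x < z then h x else 0) * g z)); last first.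
    by apply/funext => x; rewrite /k; case: ifP => // _; rewrite mul0r.
  rewrite RintegralZr_measurable ?mulr_ge0//.
  by apply: measurable_fun_ifT => //; exact: measurable_fun_ltr.
have := integrableB measurableT iwh ibh => /integrableP[_].
apply: le_lt_trans; rewrite le_eqVlt; apply/orP; left; apply/eqP.
apply: eq_integral => x _ /=.
under eq_integral do rewrite kxE normrM (ger0_norm (gx0 _ _)) EFinM.
have mEg := (measurable_EFinP _ _).2 (mgx x).
rewrite (ge0_integralZl leb measurableT mEg)//; last first.
  by move=> z _; rewrite lee_fin.
have [axb|/h0 ->] := pselect (a < x < b); last first.
  by rewrite normr0 mul0e !mulr0 subrr normr0.
rewrite kx// -EFinM -mulrBl normrM mulrC; congr ((_ * _)%:E).
rewrite ger0_norm// subr_ge0 ler_expR !mulNr lerN2 ler_wpM2l//.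
by case/andP : axb => _ /ltW.
Qed.

Lemma supported_L2_trunc a b z v : supported_L2 a b v ->
  supported_L2 a b (fun x => if x < z then v x else 0).
Proof.
move=> [mv v0 voo].
have mvz : measurable_fun setT (fun x : R => if x < z then v x else 0).
  by apply: measurable_fun_ifT => //; exact: measurable_fun_ltr.
split => //.
- by move=> x /v0 ->; case: ifP.
- apply: le_lt_trans voo; apply: ge0_le_integral => //.
  + by move=> x _; rewrite lee_fin sqr_ge0.
  + by apply/measurable_EFinP; exact: measurable_funX.
  + by apply/measurable_EFinP; exact: measurable_funX.
  + by move=> x _; rewrite lee_fin; case: ifP => // _; rewrite expr0n sqr_ge0.
Qed.

(** Causality: the value at [x] depends only on [v] to the left of [x]. Hence the quadratic form of
    [v] truncated at [z] is the partial integral of [v * Lop s v] up to [z]. *)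
Lemma Lop_trunc s z v x : x < z ->
  Lop s (fun y => if y < z then v y else 0) x = Lop s v x.
Proof.
move=> xz; apply: eq_Rintegral => y _; case: ltP => // zy.
by rewrite /pker subr_gt0 ltNge (ltW (lt_le_trans xz zy))/= !mul0r.
Qed.

(** The energy identity for the truncations makes every partial integral of [v * Lop (al + al) v]
    nonnegative. The weight may then be replaced by its infimum [expR (- e * b)] on the interval,
    whence the factor [expR (e * b)] in the constant. *)
Lemma Lop_weighted_energy (al a b e : R) : 0 < al -> al + al < 1 -> 0 <= e ->
  exists2 C : R, 0 < C & forall v, supported_L2 a b v ->
  \int[leb]_z (Lop al v z ^+ 2) <=
  C * \int[leb]_x (expR (- e * x) * (v x * Lop (al + al) v x)).
Proof.
move=> al0 al1 e0; have [C C0 HC] := Lop_energy a b al0 al1.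
have al2 : 0 < al + al by lra.
exists (C * expR (e * b)); first by rewrite mulr_gt0// expR_gt0.
move=> v Sv; have [_ ->] := HC _ Sv.
have [mv v0 _] := Sv.
rewrite -mulrA ler_wpM2l ?(ltW C0)//.
have : expR (- e * b) * \int[leb]_x (v x * Lop (al + al) v x) <=
    \int[leb]_x (expR (- e * x) * (v x * Lop (al + al) v x)).
  apply: (@le_Rintegral_expRN e a b) => //.
  - exact: (integrable_mul_Lop al2 Sv Sv).
  - by move=> x /v0 ->; rewrite mul0r.
  - move=> z; have Svz := supported_L2_trunc z Sv.
    have [_ HCz] := HC _ Svz.
    have : 0 <= C * \int[leb]_x ((if x < z then v x else 0) *
        Lop (al + al) (fun y => if y < z then v y else 0) x).
      by rewrite -HCz; apply: Rintegral_ge0 => x _; exact: sqr_ge0.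
    rewrite pmulr_rge0//; congr (0 <= _); apply: eq_Rintegral => x _.
    by case: ltP => [xz|]; rewrite ?mul0r// Lop_trunc.
rewrite mulNr expRN; set E := expR (e * b); set J := (X in _ <= X) => H.
have E0 : 0 < E by exact: expR_gt0.
by rewrite -ler_pdivrMl.
Qed.

End weighted_energy.

(** * Tempered integrals on an interval *)

Section tempered_operators.
Context {R : realType}.
Local Notation leb := (@lebesgue_measure R).
Implicit Types (s a b c x y z lam mu : R) (u v w : R -> R).

(** The exponential absorbs the tempering: [c = lam] serves the left integral and [c = - lam] the
    right one. *)
Definition tilt a b c u : R -> R := (fun x => expR (c * x) * u x) \_ `]a, b[.

Lemma tiltE a b c u x : a < x < b -> tilt a b c u x = expR (c * x) * u x.
Proof. by move=> axb; rewrite /tilt patchE mem_set//= in_itv/=. Qed.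

Lemma tilt0 a b c u x : ~ (a < x < b) -> tilt a b c u x = 0.
Proof. by move=> axb; rewrite /tilt patchE memNset//= in_itv/=. Qed.

Lemma measurable_expRM c : measurable_fun setT (fun x : R => expR (c * x)).
Proof. by apply: measurableT_comp => //; exact: measurable_funM. Qed.

Lemma supported_L2_tilt a b c u : inL2 a b u -> supported_L2 a b (tilt a b c u).
Proof.
move=> [mu uoo].
have mt : measurable_fun `]a, b[ (fun x : R => expR (c * x) * u x).
  apply: measurable_funM => //; apply: measurable_funTS.
  exact: measurable_expRM.
have mu2 : measurable_fun `]a, b[ (fun x => (u x ^+ 2)%:E).
  by apply/measurable_EFinP; exact: measurable_funX.
split.
- exact/(measurable_restrictT _ _).1.
- by move=> x; exact: tilt0.
have M0 : 0 <= expR (c * a) + expR (c * b) by rewrite addr_ge0// expR_ge0.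
(* The sum of the endpoint values bounds [expR (c * x)] on the interval for either sign of [c]. *)
pose M := (expR (c * a) + expR (c * b)) ^+ 2.
have -> : (\int[leb]_x (tilt a b c u x ^+ 2)%:E =
    \int[leb]_(x in `]a, b[) ((expR (c * x) * u x) ^+ 2)%:E)%E.
  rewrite [RHS]integral_mkcond; apply: eq_integral => x _.
  by rewrite /tilt !patchE; case: ifP => // _; rewrite expr0n.
apply: (@le_lt_trans _ _ (\int[leb]_(x in `]a, b[) (M%:E * (u x ^+ 2)%:E))%E).
  apply: ge0_le_integral => //.
  - by move=> x _; rewrite lee_fin sqr_ge0.
  - by apply/measurable_EFinP; exact: measurable_funX.
  - by apply: emeasurable_funM => //; exact: measurable_cst.
  - move=> x; rewrite /= in_itv/= => /andP[ax xb].
    rewrite -EFinM lee_fin exprMn ler_wpM2r ?sqr_ge0// ler_sqr ?nnegrE ?expR_ge0//.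
    have [c0|c0] := leP 0 c.
      apply: (@le_trans _ _ (expR (c * b))); last by rewrite lerDr expR_ge0.
      by rewrite ler_expR ler_wpM2l// ltW.
    apply: (@le_trans _ _ (expR (c * a))); last by rewrite lerDl expR_ge0.
    by rewrite ler_expR ler_wnM2l// ltW.
rewrite ge0_integralZl//; last 2 first.
- by move=> x _; rewrite lee_fin sqr_ge0.
- by rewrite lee_fin sqr_ge0.
by rewrite lte_mul_pinfty// lee_fin sqr_ge0.
Qed.

(** The tempering factor splits into a function of [x], taken out, and one of [y], absorbed by
    [tilt]. The limits of integration come from supports: [pker] vanishes for [y >= x] and [tilt]
    for [y <= a]. *)
Lemma ltRLE a b s lam u x : inL2 a b u -> a < x < b ->
  ltRL a s lam u x = expR (- lam * x) / Gamma s * Lop s (tilt a b lam u) x.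
Proof.
move=> uL2 /andP[ax xb]; have [mt _ _] := supported_L2_tilt lam uL2.
rewrite /ltRL -RintegralZl_measurable; last exact: measurable_pker_sec.
rewrite Rintegral_mkcond; apply: eq_Rintegral => y _; rewrite patchE.
have [yax|yax] := boolP (y \in `]a, x[%classic).
  move: yax; rewrite inE/= in_itv/= => /andP[ay yx].
  rewrite tiltE ?ay ?(lt_trans yx)// /pker subr_gt0 yx.
  rewrite (_ : - (lam * (x - y)) = - lam * x + lam * y); last by ring.
  by rewrite expRD; ring.
rewrite /pker subr_gt0; case: ltP => [yx|]; last by rewrite mul0r mulr0.
rewrite tilt0 ?mulr0// => /andP[ay _].
by move: yax; rewrite notin_setE/= in_itv/= ay yx.
Qed.

Lemma rtRLE a b s lam u x : inL2 a b u -> a < x < b ->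
  rtRL b s lam u x = expR (lam * x) / Gamma s * Rop s (tilt a b (- lam) u) x.
Proof.
move=> uL2 /andP[ax xb]; have [mt _ _] := supported_L2_tilt (- lam) uL2.
rewrite /rtRL -RintegralZl_measurable; last exact: measurable_pkerC_sec.
rewrite Rintegral_mkcond; apply: eq_Rintegral => y _; rewrite patchE.
have [yax|yax] := boolP (y \in `]x, b[%classic).
  move: yax; rewrite inE/= in_itv/= => /andP[xy yb].
  rewrite tiltE ?yb ?(lt_trans ax xy)// /pker subr_gt0 xy.
  rewrite (_ : - (lam * (y - x)) = lam * x + - lam * y); last by ring.
  by rewrite expRD; ring.
rewrite /pker subr_gt0; case: ltP => [xy|]; last by rewrite mul0r mulr0.
rewrite tilt0 ?mulr0// => /andP[_ yb].
by move: yax; rewrite notin_setE/= in_itv/= yb xy.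
Qed.

Let measurable_oo a b : measurable (`]a, b[%classic : set (measurableTypeR R)).
Proof. exact: measurable_itv. Qed.

Let integrable_oo a b (f : R -> \bar R) :
  leb.-integrable setT f -> leb.-integrable `]a, b[ f.
Proof. by apply: integrableS => //; exact: measurable_oo. Qed.

Lemma Rintegral_support a b (f g : R -> R) :
  (forall x, a < x < b -> f x = g x) ->
  (forall x, ~ (a < x < b) -> g x = 0) ->
  \int[leb]_(x in `]a, b[) f x = \int[leb]_x g x.
Proof.
move=> fg g0; rewrite Rintegral_mkcond; apply: eq_Rintegral => x _.
rewrite patchE; case: ifPn => [|xab].
  by rewrite inE/= in_itv/=; exact: fg.
rewrite g0// => axb; move: xab.
by rewrite notin_setE/= in_itv/= axb.
Qed.

Lemma L2inner_ltRL a b s lam u : inL2 a b u ->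
  L2inner a b (ltRL a s lam u) u =
  (Gamma s)^-1 * \int[leb]_x (tilt a b (- lam) u x * Lop s (tilt a b lam u) x).
Proof.
move=> uL2; have [mt _ _] := supported_L2_tilt lam uL2.
have [mt' _ _] := supported_L2_tilt (- lam) uL2.
rewrite -RintegralZl_measurable; last first.
  by apply: measurable_funM => //; exact: measurable_Lop.
apply: Rintegral_support => x axb; last by rewrite tilt0// mul0r mulr0.
by rewrite (ltRLE _ _ uL2 axb) tiltE//; ring.
Qed.

Lemma L2inner_rtRL a b s lam u : inL2 a b u ->
  L2inner a b u (rtRL b s lam u) =
  (Gamma s)^-1 * \int[leb]_x (tilt a b lam u x * Rop s (tilt a b (- lam) u) x).
Proof.
move=> uL2; have [mt _ _] := supported_L2_tilt lam uL2.
have [mt' _ _] := supported_L2_tilt (- lam) uL2.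
rewrite -RintegralZl_measurable; last first.
  by apply: measurable_funM => //; exact: measurable_Rop.
apply: Rintegral_support => x axb; last by rewrite tilt0// mul0r mulr0.
by rewrite (rtRLE _ _ uL2 axb) tiltE//; ring.
Qed.

Lemma L2inner_ltRL_rtRL a b s lam u : 0 < s -> inL2 a b u ->
  L2inner a b (ltRL a s lam u) u = L2inner a b u (rtRL b s lam u).
Proof.
move=> s0 uL2; rewrite (L2inner_ltRL s lam uL2) (L2inner_rtRL s lam uL2).
exact: (congr1 ( *%R (Gamma s)^-1) (Lop_adjoint s0 (supported_L2_tilt lam uL2)
  (supported_L2_tilt (- lam) uL2))).
Qed.

(** This puts the inner product into the form of the weighted estimate with [e = lam + lam]. *)
Lemma tiltN a b lam u x :
  tilt a b (- lam) u x = expR (- (lam + lam) * x) * tilt a b lam u x.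
Proof.
have [axb|axb] := pselect (a < x < b); last by rewrite !tilt0// mulr0.
by rewrite !tiltE// mulrA -expRD; congr (expR _ * _); ring.
Qed.

Lemma eq_measurable_funS (D : set R) (f g : R -> R) : measurable D ->
  measurable_fun setT g -> {in D, f =1 g} -> measurable_fun D f.
Proof.
move=> mD mg fg; apply: (@eq_measurable_fun _ _ _ _ D g).
  by move=> x xD; rewrite fg.
exact: measurable_funTS.
Qed.

Lemma measurable_ltRL a b s lam u : inL2 a b u ->
  measurable_fun `]a, b[ (ltRL a s lam u).
Proof.
move=> uL2; have [mv _ _] := supported_L2_tilt lam uL2.
apply: (@eq_measurable_funS _ _
  (fun x => expR (- lam * x) / Gamma s * Lop s (tilt a b lam u) x)) => //.
  apply: measurable_funM; last exact: measurable_Lop.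
  by apply: measurable_funM => //; exact: measurable_expRM.
by move=> x; rewrite inE/= in_itv/= => axb; rewrite (ltRLE _ _ uL2 axb).
Qed.

Lemma measurable_rtRL a b s lam u : inL2 a b u ->
  measurable_fun `]a, b[ (rtRL b s lam u).
Proof.
move=> uL2; have [mv _ _] := supported_L2_tilt (- lam) uL2.
apply: (@eq_measurable_funS _ _
  (fun x => expR (lam * x) / Gamma s * Rop s (tilt a b (- lam) u) x)) => //.
  apply: measurable_funM; last exact: measurable_Rop.
  by apply: measurable_funM => //; exact: measurable_expRM.
by move=> x; rewrite inE/= in_itv/= => axb; rewrite (rtRLE _ _ uL2 axb).
Qed.

Lemma ltRL_sq_le a b s lam u x : 0 <= lam -> inL2 a b u -> a < x < b ->
  ltRL a s lam u x ^+ 2 <=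
  (expR (- lam * a) / Gamma s) ^+ 2 * Lop s (tilt a b lam u) x ^+ 2.
Proof.
move=> lam0 uL2 axb; rewrite (ltRLE _ _ uL2 axb) exprMn.
rewrite ler_wpM2r ?sqr_ge0// !exprMn ler_wpM2r ?sqr_ge0//.
rewrite ler_sqr ?nnegrE ?expR_ge0// ler_expR !mulNr lerN2 ler_wpM2l//.
by case/andP : axb => /ltW.
Qed.

Lemma ltRL_square_integrable a b al lam u : 0 < al -> al + al < 1 ->
  0 <= lam -> inL2 a b u ->
  leb.-integrable `]a, b[ (EFin \o (fun x => ltRL a al lam u x ^+ 2)).
Proof.
move=> al0 al1 lam0 uL2; have [C _ HC] := Lop_energy a b al0 al1.
have [iL _] := HC _ (supported_L2_tilt lam uL2).
have := integrableZl (measurable_oo a b)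
  ((expR (- lam * a) / Gamma al) ^+ 2) (integrable_oo a b iL).
apply: le_integrable => //.
- apply/measurable_EFinP; apply: measurable_funX; exact: measurable_ltRL.
- move=> x; rewrite /= in_itv/= => axb; rewrite lee_fin.
  rewrite (ger0_norm (sqr_ge0 _)).
  rewrite (ger0_norm (mulr_ge0 (sqr_ge0 _) (sqr_ge0 _))).
  exact: ltRL_sq_le.
Qed.

(** On the interval [expR (- lam * x) <= expR (- lam * a)], which gives [K]. Passing to the whole
    line only increases the integral of the square, and there the weighted estimate applies.
    [Gamma (al + al)] undoes the normalization of the inner product. *)
Lemma ltRL_energy a b al lam : 0 < al -> al + al < 1 -> 0 <= lam ->
  exists2 C : R, 0 < C & forall u, inL2 a b u ->
  L2normsq a b (ltRL a al lam u) <= C * L2inner a b (ltRL a (al + al) lam u) u.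
Proof.
move=> al0 al1 lam0; have lam2 : 0 <= lam + lam by rewrite addr_ge0.
have [C C0 HC] := Lop_weighted_energy a b al0 al1 lam2.
have [C' _ HC'] := Lop_energy a b al0 al1.
have G1 : 0 < Gamma al by apply: Gamma_gt0; lra.
have G2 : 0 < Gamma (al + al) by apply: Gamma_gt0; lra.
pose K := (expR (- lam * a) / Gamma al) ^+ 2.
have K0 : 0 < K.
  by apply: exprn_gt0; apply: divr_gt0 G1; exact: expR_gt0.
exists (K * C * Gamma (al + al)); first exact: mulr_gt0 (mulr_gt0 K0 C0) G2.
move=> u uL2; have Sv := supported_L2_tilt lam uL2; have [iL _] := HC' _ Sv.
rewrite (L2inner_ltRL _ _ uL2) mulrA mulfK ?gt_eqF//.
under eq_Rintegral do rewrite tiltN -mulrA.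
rewrite -mulrA; apply: (@le_trans _ _
    (K * \int[leb]_z (Lop al (tilt a b lam u) z ^+ 2))); last first.
  by rewrite ler_wpM2l ?(ltW K0)//; exact: HC.
have iLab := integrable_oo a b iL.
apply: (@le_trans _ _
    (K * \int[leb]_(z in `]a, b[) (Lop al (tilt a b lam u) z ^+ 2))).
  rewrite -RintegralZl//; apply: le_Rintegral => //.
  - exact: ltRL_square_integrable.
  - exact: (integrableZl (measurable_oo a b) K iLab).
  - by move=> x; rewrite /= in_itv/= => axb; exact: ltRL_sq_le.
rewrite ler_wpM2l ?(ltW K0)//; apply: fine_le.
- exact: (integrable_fin_num (measurable_oo a b) iLab).
- exact: (integrable_fin_num measurableT iL).
- apply: ge0_subset_integral => //; first exact: measurable_int iL.
  by move=> z _; rewrite lee_fin sqr_ge0.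
Qed.

(** * Reflection of the interval, exchanging left and right *)

Lemma inL2_reflect a b u : inL2 a b u -> inL2 (- b) (- a) (fun x => u (- x)).
Proof.
move=> [mu uoo]; split.
  change (measurable_fun `](- b), (- a)[ (u \o -%R)).
  apply: (measurable_comp _ _ mu) => //.
  by move=> _ [x /= + <-]; rewrite !in_itv/= ltrNl ltrNr andbC.
have mu2 : measurable_fun `]a, b[ (fun x => (u x ^+ 2)%:E).
  by apply/measurable_EFinP; exact: measurable_funX.
apply: le_lt_trans uoo; rewrite [leRHS](ge0_integral_reflect _ mu2)//.
  by rewrite opp_preimage_itvbndbnd.
by move=> x _; rewrite lee_fin sqr_ge0.
Qed.

Lemma RintegralT_reflect (f : R -> R) : measurable_fun setT f ->
  \int[leb]_x f x = \int[leb]_x f (- x).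
Proof.
move=> mf; rewrite /Rintegral (integral_reflect measurableT); last first.
  exact/measurable_EFinP.
by rewrite preimage_setT.
Qed.

Lemma Rop_reflect s v x : measurable_fun setT v ->
  Rop s v x = Lop s (fun y => v (- y)) (- x).
Proof.
move=> mv; rewrite /Rop (RintegralT_reflect (measurable_pkerC_sec s x mv)).
by apply: eq_Rintegral => y _; rewrite addrC.
Qed.

(** The parameter [lam] keeps its sign: reflecting the tilt of parameter [- lam] yields the tilt of
    parameter [lam] on the reflected interval. Bounds for left integrals thus transfer to right
    ones. *)
Lemma rtRL_reflect a b s lam u x : inL2 a b u -> a < x < b ->
  rtRL b s lam u x = ltRL (- b) s lam (fun y => u (- y)) (- x).
Proof.
move=> uL2 axb; have [mv _ _] := supported_L2_tilt (- lam) uL2.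
have axbN : - b < - x < - a by rewrite !ltrN2 andbC.
rewrite (rtRLE _ _ uL2 axb) (ltRLE _ _ (inL2_reflect uL2) axbN).
rewrite (Rop_reflect _ _ mv) mulrNN.
rewrite (_ : (fun y => tilt a b (- lam) u (- y)) =
  tilt (- b) (- a) lam (fun y => u (- y)))//.
apply/funext => y; have ybaE : (a < - y < b) = (- b < y < - a).
  by rewrite ltrNr ltrNl andbC.
have [ayb|ayb] := pselect (a < - y < b).
  by rewrite !tiltE -?ybaE// mulrNN.
by rewrite !tilt0 -?ybaE.
Qed.

Lemma Rintegral_reflectN a b (f : R -> R) : measurable_fun `](- b), (- a)[ f ->
  \int[leb]_(x in `](- b), (- a)[) f x = \int[leb]_(x in `]a, b[) f (- x).
Proof. by move=> mf; rewrite (Rintegral_reflect mf) !opprK. Qed.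

Lemma L2normsq_rtRL a b s lam u : inL2 a b u ->
  L2normsq a b (rtRL b s lam u) =
  L2normsq (- b) (- a) (ltRL (- b) s lam (fun y => u (- y))).
Proof.
move=> uL2; rewrite /L2normsq Rintegral_reflectN; last first.
  by apply: measurable_funX; apply: measurable_ltRL; exact: inL2_reflect.
apply: eq_Rintegral => x; rewrite inE/= in_itv/= => axb.
by rewrite (rtRL_reflect _ _ uL2 axb).
Qed.

Lemma L2inner_rtRL_reflect a b s lam u : inL2 a b u ->
  L2inner (- b) (- a) (ltRL (- b) s lam (fun y => u (- y))) (fun y => u (- y)) =
  L2inner a b u (rtRL b s lam u).
Proof.
move=> uL2; have uL2N := inL2_reflect uL2; have [muN _] := uL2N.
rewrite /L2inner Rintegral_reflectN; last first.
  by apply: measurable_funM => //; exact: measurable_ltRL.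
apply: eq_Rintegral => x; rewrite inE/= in_itv/= => axb.
by rewrite (rtRL_reflect _ _ uL2 axb) opprK mulrC.
Qed.

Lemma rtRL_square_integrable a b al lam u : 0 < al -> al + al < 1 ->
  0 <= lam -> inL2 a b u ->
  leb.-integrable `]a, b[ (EFin \o (fun x => rtRL b al lam u x ^+ 2)).
Proof.
move=> al0 al1 lam0 uL2; have uL2N := inL2_reflect uL2.
have /integrableP[mf foo] := ltRL_square_integrable al0 al1 lam0 uL2N.
apply/integrableP; split.
  by apply/measurable_EFinP; apply: measurable_funX; exact: measurable_rtRL.
apply: le_lt_trans foo; rewrite [leRHS]ge0_integral_reflect//; last first.
  exact: measurableT_comp.
rewrite opp_preimage_itvbndbnd !opprK le_eqVlt; apply/orP; left; apply/eqP.
apply: eq_integral => x; rewrite inE/= in_itv/= => axb.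
by rewrite (rtRL_reflect _ _ uL2 axb).
Qed.

(** * The mixed inner product of the right and left integrals *)

Lemma Lop0 s a b v z : supported_L2 a b v -> z <= a -> Lop s v z = 0.
Proof.
move=> [_ v0 _] za; rewrite /Lop /Rintegral integral0_eq// => y _.
rewrite /pker subr_gt0; case: ltP => [yz|]; last by rewrite mul0r.
by rewrite v0 ?mulr0// => /andP[ay _]; move: (lt_le_trans yz za); rewrite ltNge ltW.
Qed.

Lemma Rop0 s a b v z : supported_L2 a b v -> b <= z -> Rop s v z = 0.
Proof.
move=> [_ v0 _] bz; rewrite /Rop /Rintegral integral0_eq// => y _.
rewrite /pker subr_gt0; case: ltP => [zy|]; last by rewrite mul0r.
by rewrite v0 ?mulr0// => /andP[_ yb]; move: (le_lt_trans bz zy); rewrite ltNge ltW.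
Qed.

(** On the interval the factors [expR (lam * z)] and [expR (- lam * z)] cancel. Off it the product
    vanishes, through [Lop] for [z <= a] and through [Rop] for [z >= b]. The mixed product is
    therefore an integral over the line, where the Beta identity applies; [K] collects its constant
    and the Gamma factors. *)
Lemma L2inner_ltRL_mix a b al lam : 0 < al -> al + al < 1 ->
  exists2 K : R, 0 < K & forall u, inL2 a b u ->
  L2inner a b (ltRL a (al + al) lam u) u =
  K * L2inner a b (rtRL b al lam u) (ltRL a al lam u).
Proof.
move=> al0 al1; have al01 : 0 < al < 1 by rewrite al0; lra.
have [B B0 HB] := Lop_Rop_energy a b al01.
have G1 : 0 < Gamma al by apply: Gamma_gt0.
have G2 : 0 < Gamma (al + al) by apply: Gamma_gt0; lra.
exists (Gamma al ^+ 2 / B / Gamma (al + al)).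
  by rewrite !divr_gt0// exprn_gt0.
move=> u uL2; have Sv := supported_L2_tilt lam uL2.
have Sw := supported_L2_tilt (- lam) uL2.
have [mv _ _] := Sv; have [mw _ _] := Sw.
rewrite (L2inner_ltRL _ _ uL2).
have -> : L2inner a b (rtRL b al lam u) (ltRL a al lam u) =
    (Gamma al ^+ 2)^-1 * \int[leb]_z
      (Rop al (tilt a b (- lam) u) z * Lop al (tilt a b lam u) z).
  rewrite -RintegralZl_measurable; last first.
    by apply: measurable_funM; [exact: measurable_Rop|exact: measurable_Lop].
  apply: Rintegral_support => z azb.
    rewrite (rtRLE _ _ uL2 azb) (ltRLE _ _ uL2 azb).
    have E : expR (lam * z) * expR (- lam * z) = 1.
      by rewrite -expRD mulNr subrr expR0.
    rewrite -[RHS]mul1r -E; field; lra.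
  have [za|az] := leP z a; first by rewrite (Lop0 _ Sv za) !mulr0.
  have [bz|zb] := leP b z; first by rewrite (Rop0 _ Sw bz) mul0r mulr0.
  by case: azb; rewrite az zb.
rewrite (HB _ _ Sv Sw); field; rewrite ?gt_eqF//.
Qed.

(** Integration of [t * (f - g / t)^2 >= 0]; square integrability makes the product integrable. The
    weight [t] stays free, to be tuned for the absorption. *)
Lemma L2inner_AMGM a b (f g : R -> R) (t : R) : 0 < t ->
  measurable_fun `]a, b[ f -> measurable_fun `]a, b[ g ->
  leb.-integrable `]a, b[ (EFin \o (fun x => f x ^+ 2)) ->
  leb.-integrable `]a, b[ (EFin \o (fun x => g x ^+ 2)) ->
  L2inner a b f g *+ 2 <= t * L2normsq a b f + t^-1 * L2normsq a b g.
Proof.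
move=> t0 mf mg if2 ig2; have mab := measurable_oo a b.
have itf := integrableZl mab t if2.
have itg := integrableZl mab t^-1 ig2.
have ifg : leb.-integrable `]a, b[ (EFin \o (fun x => f x * g x)).
  have := integrableD mab if2 ig2; apply: le_integrable => //.
    by apply/measurable_EFinP; exact: measurable_funM.
  move=> x _; rewrite lee_fin (ger0_norm (addr_ge0 (sqr_ge0 _) (sqr_ge0 _))).
  rewrite normrM -(real_normK (num_real (f x))) -(real_normK (num_real (g x))).
  have : 0 <= (`|f x| - `|g x|) ^+ 2 by exact: sqr_ge0.
  have : 0 <= `|f x| * `|g x| by rewrite mulr_ge0.
  rewrite sqrrB; lra.
rewrite /L2inner /L2normsq -!RintegralZl// -RintegralD// -mulr_natl -RintegralZl//.
apply: le_Rintegral => //.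
- exact: (integrableZl mab 2 ifg).
- exact: (integrableD mab itf itg).
move=> x _; have : 0 <= t * (f x - t^-1 * g x) ^+ 2.
  by rewrite mulr_ge0 ?sqr_ge0// ltW.
rewrite (_ : t * (f x - t^-1 * g x) ^+ 2 =
  t * f x ^+ 2 + t^-1 * g x ^+ 2 - 2 * (f x * g x)) ?subr_ge0//.
by field; rewrite gt_eqF.
Qed.

End tempered_operators.

Theorem theorem3 (R : realType) (a b lam mu : R) :
  a < b -> 0 <= lam -> 0 < mu < 1 ->
  exists C1 C2 C3 C4 : R, [/\ 0 < C1, 0 < C2, 0 < C3, 0 < C4 &
    forall u : R -> R, inL2 a b u ->
      let I := L2inner a b (ltRL a mu lam u) u in
      [/\ C1 * L2normsq a b (ltRL a (mu / 2) lam u) <= I,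
          I <= C2 * L2normsq a b (ltRL a (mu / 2) lam u),
          I = L2inner a b u (rtRL b mu lam u),
          C3 * L2normsq a b (rtRL b (mu / 2) lam u) <= I &
          I <= C4 * L2normsq a b (rtRL b (mu / 2) lam u)]].
Proof.
move=> _ lam0 /andP[mu0 mu1].
have [al muE] : {al | mu = al + al} by exists (mu / 2); field.
have -> : mu / 2 = al by rewrite muE; field.
rewrite muE; have al0 : 0 < al by lra.
have al1 : al + al < 1 by lra.
have [Cl Cl0 HCl] := ltRL_energy a b al0 al1 lam0.
have [Cr Cr0 HCr] := ltRL_energy (- b) (- a) al0 al1 lam0.
have [K K0 HK] := L2inner_ltRL_mix a b lam al0 al1.
(* The lower constants invert the two energy bounds; each upper constant carries the energy constant
   of the opposite side. *)
exists Cl^-1, (K ^+ 2 * Cr), Cr^-1, (K ^+ 2 * Cl).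
split; rewrite ?invr_gt0 ?mulr_gt0 ?exprn_gt0// => u uL2.
have al2 : 0 < al + al by lra.
have Isym := L2inner_ltRL_rtRL lam al2 uL2.
(* The right bound is the left one for the reflected function on the reflected interval, carried
   back next. *)
move: (HCl _ uL2) (HCr _ (inL2_reflect uL2)) (HK _ uL2).
rewrite -(L2normsq_rtRL al lam uL2) (L2inner_rtRL_reflect _ _ uL2) -Isym.
have AMGM t (t0 : 0 < t) := L2inner_AMGM t0
  (measurable_rtRL al lam uL2) (measurable_ltRL al lam uL2)
  (rtRL_square_integrable al0 al1 lam0 uL2)
  (ltRL_square_integrable al0 al1 lam0 uL2).
move: AMGM; rewrite /=.
set I := L2inner a b (ltRL _ _ _ _) u; set P := L2inner a b (rtRL _ _ _ _) _.
set X := L2normsq a b (ltRL _ _ _ _); set Y := L2normsq a b (rtRL _ _ _ _).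
move=> AMGM HX HY HI; split => //.
- by rewrite ler_pdivrMl.
(* With [t = 1 / (K Cr)], multiplying by [K] gives [2 I <= Y / Cr + K^2 Cr X], and [Y / Cr <= I] is
   absorbed on the left. *)
- have := AMGM (K * Cr)^-1; rewrite invr_gt0 mulr_gt0// => /(_ isT).
  rewrite invrK -(ler_pM2l K0) -mulr_natl mulrCA -HI.
  have -> : K * ((K * Cr)^-1 * Y + K * Cr * X) = Cr^-1 * Y + K ^+ 2 * Cr * X.
    by field; rewrite !gt_eqF.
  have : Cr^-1 * Y <= I by rewrite ler_pdivrMl.
  lra.
- by rewrite ler_pdivrMl.
(* With [t = K Cl] the absorbed term is [X / Cl <= I]. *)
- have := AMGM (K * Cl); rewrite mulr_gt0// => /(_ isT).
  rewrite -(ler_pM2l K0) -mulr_natl mulrCA -HI.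
  have -> : K * (K * Cl * Y + (K * Cl)^-1 * X) = Cl^-1 * X + K ^+ 2 * Cl * Y.
    by field; rewrite !gt_eqF.
  have : Cl^-1 * X <= I by rewrite ler_pdivrMl.
  lra.
Qed.
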